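(* Let $\underline{T}=(T_1,\dots,T_d)$ be a $d$-tuple of commuting contractions on a Hilbert space $\mathcal H$, and let $P=T_1T_2\cdots T_d$. Then the following are equivalent. (1) $\mathcal T(\underline T)$ is non-trivial, i.e., contains a non-zero operator. (2) The adjoint $P^*$ of the product contraction is not pure, i.e., $P^n\nrightarrow 0$ strongly as $n\to\infty$. (3) There exists a unique (up to unitary equivalence) canonical unitary pseudo-extension of $\underline T$.
   Context: Hilbert spaces are complex; operators are bounded and linear. A contraction $C$ is pure if $C^{*n}\to 0$ strongly. For a commuting tuple of contractions $\underline T=(T_1,\dots,T_d)$ on $\mathcal H$, $\mathcal T(\underline T)=\{A\in\mathcal B(\mathcal H): T_i^*AT_i=A \text{ for } 1\le i\le d\}$ is the space of $\underline T$-Toeplitz operators. The product contraction of $\underline T$ is $P=T_1T_2\cdots T_d$. A pseudo-extension of a $d$-tuple $\underline T$ of commuting bounded operators on $\mathcal H$ is a triple $(\mathfrak J,\mathcal K,\underline U)$ where $\mathcal K$ is a Hilbert space, $\underline U=(U_1,\dots,U_d)$ is a $d$-tuple of commuting bounded operators on $\mathcal K$, and $\mathfrak J:\mathcal H\to\mathcal K$ is a non-zero contraction with $\mathfrak J T_j=U_j\mathfrak J$ for every $j=1,\dots,d$. It is a unitary pseudo-extension if every $U_j$ is unitary. It is minimal if $\mathcal K$ is the smallest closed subspace reducing each $U_j$ and containing $\mathfrak J\mathcal H$. A minimal pseudo-extension of a tuple of commuting contractions is canonical if $\mathfrak J^*\mathfrak J=\operatorname{SOT-}\lim_{n\to\infty}P^{*n}P^n$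 (this strong operator limit exists because $P$ is a contraction). Two pseudo-extensions $(\mathfrak J,\mathcal K,\underline U)$ and $(\tilde{\mathfrak J},\tilde{\mathcal K},\tilde{\underline U})$ of $\underline T$ are unitarily equivalent if there is a unitary $W:\mathcal K\to\tilde{\mathcal K}$ with $WU_j=\tilde U_jW$ for all $j$ and $W\mathfrak J=\tilde{\mathfrak J}$. *)

(* Defs.v *)
From HB Require Import structures.
From mathcomp Require Import all_boot all_order all_algebra.
From mathcomp Require Import sesquilinear complex.
From mathcomp Require Import all_classical all_reals all_analysis.

Set Implicit Arguments.
Unset Strict Implicit.
Unset Printing Implicit Defensive.

Import Order.TTheory GRing.Theory Num.Theory.
Import numFieldNormedType.Exports.

Local Open Scope classical_set_scope.
Local Open Scope ring_scope.
Local Open Scope complex_scope.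

(* Complex Hilbert spaces. The norm of a normed module over [R[i]] takes its
   values in [R[i]]; [inner] is linear in its first argument and
   conjugate-linear in the second. *)
HB.mixin Record isHilbert (R : realType) V & CompleteNormedModule R[i] V := {
  inner : {dot V for Num.conj};
  sqr_norm_inner : forall x : V, `|x| ^+ 2 = inner x x }.

#[short(type="hilbertType")]
HB.structure Definition Hilbert (R : realType) :=
  {V of CompleteNormedModule R[i] V & isHilbert R V}.

Section Operators.
Variable R : realType.
Implicit Types H K : hilbertType R.

Definition bounded_op H K (A : H -> K) : Prop :=
  exists M : R[i], forall x, `|A x| <= M * `|x|.

Definition contraction_op H K (A : H -> K) : Prop := forall x, `|A x| <= `|x|.

(* For a bounded linear [A], the Riesz representation theorem provides for
   each [y] a (unique) [z] with the property below; for other maps the value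
   is irrelevant. *)
Definition adjoint H K (A : H -> K) (y : K) : H :=
  get [set z : H | forall x, inner (A x) y = inner x z].

Lemma adjoint_eq H K (A : H -> K) (B : K -> H) :
  (forall x y, inner (A x) y = inner x (B y)) -> adjoint A = B.
Proof.
move=> AB; apply/funext => y; rewrite /adjoint; case: xgetP => [z _ zP|/(_ (B y))].
  apply/eqP; rewrite -subr_eq0 -normr_eq0 -sqrf_eq0 sqr_norm_inner linearBr.
  by rewrite -[X in X - _]zP AB subrr.
by case=> x; exact: AB.
Qed.

Definition unitary_op H K (W : H -> K) : Prop :=
  [/\ bounded_op W, cancel W (adjoint W) & cancel (adjoint W) W].

Definition pure H (C : H -> H) : Prop :=
  forall x, (fun n : nat => iter n (adjoint C) x) @ \oo --> (0 : H).

Definition SOT_cvg H (A : nat -> H -> H) (L : H -> H) : Prop :=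
  forall x, (fun n => A n x) @ \oo --> L x.

Definition closed_subspace H (M : set H) : Prop :=
  [/\ closed M, M 0 & forall (a : R[i]) x y, M x -> M y -> M (a *: x + y)].

Definition orthocomplement H (M : set H) : set H :=
  [set y | forall x, M x -> inner x y = 0].

Definition reduces H (M : set H) (A : H -> H) : Prop :=
  A @` M `<=` M /\ A @` orthocomplement M `<=` orthocomplement M.

Definition commuting H d (T : 'I_d -> {linear H -> H}) : Prop :=
  forall i j x, T i (T j x) = T j (T i x).

Definition product_op H d (T : 'I_d -> {linear H -> H}) : H -> H :=
  \big[(fun A B : H -> H => A \o B) / id]_(i < d) (T i : H -> H).

Definition toeplitz_ops H d (T : 'I_d -> {linear H -> H}) :
    set {linear H -> H} :=
  [set A | bounded_op A /\ forall i x, adjoint (T i) (A (T i x)) = A x].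

End Operators.

Record triple (R : realType) (H : hilbertType R) (d : nat) := Triple {
  ext_space : hilbertType R;
  ext_map : {linear H -> ext_space};
  ext_ops : 'I_d -> {linear ext_space -> ext_space} }.

Section PseudoExtensions.
Variables (R : realType) (H : hilbertType R) (d : nat).
Variable T : 'I_d -> {linear H -> H}.
Implicit Types E F : triple H d.

Definition pseudo_extension E : Prop :=
  [/\ commuting (ext_ops E),
      forall j, bounded_op (ext_ops E j),
      contraction_op (ext_map E),
      exists x, ext_map E x <> 0
    & forall j x, ext_map E (T j x) = ext_ops E j (ext_map E x)].

Definition unitary_pseudo_extension E : Prop :=
  pseudo_extension E /\ forall j, unitary_op (ext_ops E j).

Definition minimal E : Prop :=
  forall M : set (ext_space E), closed_subspace M ->
    (forall j, reduces M (ext_ops E j)) -> range (ext_map E) `<=` M ->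
    M = setT.

Definition canonical E : Prop :=
  minimal E /\
  SOT_cvg
    (fun n => iter n (adjoint (product_op T)) \o iter n (product_op T))
    (adjoint (ext_map E) \o ext_map E).

Definition canonical_unitary_pseudo_extension E : Prop :=
  unitary_pseudo_extension E /\ canonical E.

Definition unitarily_equivalent E F : Prop :=
  exists W : {linear ext_space E -> ext_space F},
    [/\ unitary_op W,
        forall j x, W (ext_ops E j x) = ext_ops F j (W x)
      & forall x, W (ext_map E x) = ext_map F x].

End PseudoExtensions.

(* Main.v *)
Require Import Defs.
From HB Require Import structures.
From mathcomp Require Import all_boot all_order all_algebra.
From mathcomp Require Import sesquilinear complex.
From mathcomp Require Import all_classical all_reals all_analysis.
From mathcomp Require Import ring lra.

Set Implicit Arguments.
Unset Strict Implicit.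
Unset Printing Implicit Defensive.

Import Order.TTheory GRing.Theory Num.Theory.
Import numFieldNormedType.Exports.

Local Open Scope classical_set_scope.
Local Open Scope ring_scope.

(** Let [P] be the product contraction.  The norms [|P^n x|] decrease, and the
    whole theorem turns on the seminorm [lim |P^n x|], which vanishes
    identically exactly when [P^n] tends to [0] strongly.

    A Toeplitz operator [A] satisfies [<A (P^n x), P^n y> = <A x, y>] for every
    [n], so it is zero as soon as [P^n] tends to [0] strongly
    ([toeplitz_not_pure]).  Conversely, if [J] intertwines the tuple with
    commuting unitaries [U_j], then
    [<J (T_j x), J (T_j y)> = <U_j (J x), U_j (J y)> = <J x, J y>], so
    that [J^* J] is a Toeplitz operator, nonzero because [J] is
    ([unitary_pseudo_extension_toeplitz]).

    It remains to produce a canonical unitary pseudo-extension when some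
    [P^n x] does not tend to [0], and to show that it is unique.  The usual route
    has three stages: divide [H] by the kernel of the seminorm and complete it, so
    that the [T_j] become commuting isometries, and then extend these to
    unitaries.  All three are done at once by the space of asymptotic orbits,
    the sequences [x] of vectors of [H] for which [x (n + k)] is close to
    [P^n (x k)] for all [n] when [k] is large.  Such a sequence
    stands for the limit of [U_P^(-n) (J (x n))], where [U_P] is the product of
    the unitaries to be constructed.  Along two asymptotic orbits the inner
    products [<x n, y n>] converge; this limit is a positive form for which the
    space is already complete, so that the Hausdorff quotient [K] is a Hilbert
    space ([asymptotic_completion]).  Now
    - [J x] is the class of the honest orbit [(P^n x)_n], whence
      [|J x| = lim |P^n x|], and this forces [P^*^n P^n] to converge strongly to
      [J^* J] ([SOT_of_norm_iter]);
    - [U_j] applies [T_j] to every term, and the product of the [U_j] is the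
      left shift, whose inverse is the right shift.  As each [U_j] is a
      contraction which divides this unitary, it is itself
      unitary ([unitary_of_product]);
    - the class of [x] is the limit of [U_P^(-n) (J (x n))] ([model_approx]), so
      the range of [J] generates [K] ([model_minimal]).

    For another canonical unitary pseudo-extension [(J', K', U')], send the class
    of [x] to the limit of [U'_P^(-n) (J' (x n))].  This map is isometric, since
    canonicity gives [|J' x| = lim |P^n x| = |J x|]; it intertwines everything,
    and its range is a closed reducing subspace containing the range of [J'],
    hence is all of [K'] by minimality ([model_universal]). *)

(** * Convergent sequences *)

Section EpsilonCriteria.
Variable K : numFieldType.

Lemma cvgn_leP (V : normedModType K) (u : nat -> V) (l : V) :
  u @ \oo --> l <->
  forall e : K, 0 < e -> exists N, forall n, (N <= n)%N -> `|u n - l| <= e.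
Proof.
split=> [/cvgrPdist_le ul e e0|ul].
  by have [N _ uN] := ul e e0; exists N => n Nn; rewrite distrC; exact: uN.
apply/cvgrPdist_le => e e0; have [N uN] := ul e e0.
by exists N => // n Nn /=; rewrite distrC; exact: uN.
Qed.

Definition cauchy_seq (V : normedZmodType K) (u : nat -> V) :=
  forall e : K, 0 < e -> exists N, forall m n,
    (N <= m)%N -> (N <= n)%N -> `|u m - u n| <= e.

Lemma cauchy_seq_cvgn (V : completeNormedModType K) (u : nat -> V) :
  cauchy_seq u -> exists l : V, u @ \oo --> l.
Proof.
move=> uC; apply/cvg_ex; apply: cauchy_cvg; apply/cauchy_ballP => e e0.
have e20 : 0 < e / 2 by rewrite divr_gt0.
have [N uN] := uC _ e20.
have tail : (u @ \oo) (u @` [set n | (N <= n)%N]) by exists N => // n Nn; exists n.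
exists (u @` [set n | (N <= n)%N], u @` [set n | (N <= n)%N]) => //=.
move=> [x y] [/= [m Nm <-] [n Nn <-]]; rewrite -ball_normE /=.
by rewrite (le_lt_trans (uN m n Nm Nn))// gtr_pMr ?invf_lt1 ?ltr1n.
Qed.

Lemma cvgn_cauchy_seq (V : normedModType K) (u : nat -> V) (l : V) :
  u @ \oo --> l -> cauchy_seq u.
Proof.
move=> /cvgn_leP ul e e0; have e20 : 0 < e / 2 by rewrite divr_gt0.
have [N uN] := ul _ e20; exists N => m n Nm Nn.
by rewrite (splitr e) (le_trans (ler_distD l _ _))// lerD ?uN// distrC uN.
Qed.

Lemma cvgn_uniq (V : normedModType K) (u : nat -> V) (l l' : V) :
  u @ \oo --> l -> u @ \oo --> l' -> l = l'.
Proof. exact: (cvg_unique (@norm_hausdorff _ _)). Qed.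

Lemma cvgn_squeeze (V W : normedModType K) (u : nat -> V) (l : V)
    (v : nat -> W) (m : W) :
  (forall n, `|v n - m| <= `|u n - l|) -> u @ \oo --> l -> v @ \oo --> m.
Proof.
move=> vu /cvgn_leP ul; apply/cvgn_leP => e /ul [N uN]; exists N => n /uN.
exact: le_trans.
Qed.

Lemma closed_approxP (V : normedModType K) (A : set V) :
  (forall x, (forall e : K, 0 < e -> exists2 y, A y & `|x - y| <= e) -> A x) ->
  closed A.
Proof.
move=> approx x clx; apply: approx => e e0.
have [y [Ay xy]] := clx _ (nbhsx_ballx x e e0); exists y => //.
by move: xy; rewrite -ball_normE /= => /ltW.
Qed.

End EpsilonCriteria.

Section ComplexLimits.
Variable R : realType.

Lemma gt0_complexP (e : R[i]) : 0 < e -> exists2 r : R, 0 < r & e = (r%:C)%C.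
Proof.
by move=> e0; have /complex_realP[r er] := gtr0_real e0; exists r => //;
  move: e0; rewrite er ltcR.
Qed.

Lemma invn_small (e : R[i]) : 0 < e -> exists N, forall n, (N <= n)%N ->
  n.+1%:R^-1 <= e.
Proof.
move=> /gt0_complexP[r r0 ->].
have [N _ NP] := near_infty_natSinv_lt (PosNum r0); exists N => n /NP /=.
by rewrite -ltcR fmorphV /= rmorph_nat => /ltW.
Qed.

Lemma complex_cauchy_cvgn (u : nat -> R[i]) :
  cauchy_seq u -> exists l : R[i]^o, u @ \oo --> l.
Proof.
move=> uC.
(* the two coordinates are additive and do not increase the modulus *)
have part (p : R[i] -> R) (pD : {morph p : x y / x - y})
    (pn : forall x, (`|p x|%:C)%C <= `|x|) : exists l : R, (p \o u) @ \oo --> l.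
  apply: (@cauchy_seq_cvgn _ R) => e e0.
  have [|N uN] := uC (e%:C)%C; first by rewrite ltcR.
  exists N => m n Nm Nn /=; rewrite -pD -lecR.
  exact: le_trans (pn _) (uN _ _ Nm Nn).
have [] := part (@complex.Re R); [by case=> ? ? [? ?]|exact: normc_ge_Re|].
move=> a /cvgn_leP ua.
have [] := part (@complex.Im R); first by case=> ? ? [? ?].
  by case=> c d; rewrite normc_def lecR -sqrtr_sqr ler_wsqrtr//= lerDr sqr_ge0.
move=> b /cvgn_leP ub; exists (a +i* b)%C; apply/(@cvgn_leP _ R[i]^o) => e.
move=> /gt0_complexP[r r0 ->].
have r20 : 0 < r / 2 by rewrite divr_gt0.
have [N1 ua1] := ua _ r20; have [N2 ub2] := ub _ r20.
exists (maxn N1 N2) => n; rewrite geq_max => /andP[/ua1/= un1 /ub2/= un2].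
rewrite [u n - _](complexE _) (le_trans (ler_normD _ _))//.
rewrite normrM (_ : `|'i%C| = 1) ?mul1r.
  have reE (s : R) : `|(s%:C)%C| = (`|s|%:C)%C.
    by rewrite normc_def /= expr0n addr0 sqrtr_sqr.
  rewrite !reE -rmorphD lecR (splitr r) lerD//.
    by case: (u n) un1.
  by case: (u n) un2.
by rewrite normc_def /= expr0n expr1n add0r sqrtr1.
Qed.

(** Past a suitable index the sequence never exceeds by more than [e] a value
    that is itself within [e] of the infimum of the tail, so it stays in an
    interval of length [2 e].  This replaces monotone convergence for the norms
    along an asymptotic orbit, which decrease only up to a small error. *)
Lemma almost_noninc_cauchy_seq (u : nat -> R[i]) :
  (forall n, 0 <= u n) ->
  (forall e, 0 < e -> exists N, forall k n, (N <= k)%N -> u (n + k)%N <= u k + e) ->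
  cauchy_seq u.
Proof.
move=> u0 udec e /gt0_complexP[r r0 ->]; pose v n := complex.Re (u n).
have uE n : u n = ((v n)%:C)%C by rewrite RRe_real ?ger0_real.
have r2 : 0 < r / 2 by rewrite divr_gt0.
have [|N uN] := udec ((r / 2)%:C)%C; first by rewrite ltcR.
pose D := [set v k | k in [set k | (N <= k)%N]].
have D_inf : has_inf D.
  split; first by exists (v N), N => /=.
  by exists 0 => _ [n _ <-]; rewrite -lecR -uE.
have [_ [k /= Nk <-] kinf] := inf_adherent r2 D_inf.
have between n : (k <= n)%N -> inf D <= v n <= inf D + r.
  move=> kn; apply/andP; split.
    by apply: ge_inf; [case: D_inf|exists n => //=; exact: leq_trans kn].
  rewrite (splitr r) addrA (@le_trans _ _ (v k + r / 2)) ?lerD2r ?(ltW kinf)//.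
  by rewrite -lecR rmorphD /= -!uE -(subnK kn) uN.
exists k => m n /between/andP[m1 m2] /between/andP[n1 n2].
rewrite !uE -rmorphB normc_def /= expr0n addr0 sqrtr_sqr lecR ler_norml.
by apply/andP; split; lra.
Qed.

End ComplexLimits.

(** Limits are taken in the regular module [R[i]^o], because [R[i]] itself
    carries its module structure over [R] rather than over [R[i]]. *)
Definition ccvg (R : realType) (u : nat -> R[i]) (l : R[i]) : Prop :=
  u @ \oo --> (l : R[i]^o).

Section ComplexConvergence.
Variable R : realType.
Implicit Types (u v : nat -> R[i]) (a l m : R[i]).

Lemma ccvgP u l : ccvg u l <->
  forall e : R[i], 0 < e -> exists N, forall n, (N <= n)%N -> `|u n - l| <= e.
Proof. exact: (@cvgn_leP _ R[i]^o). Qed.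

Lemma ccvg_uniq u l m : ccvg u l -> ccvg u m -> l = m.
Proof. exact: (@cvgn_uniq _ R[i]^o). Qed.

Lemma ccvg_cst a : ccvg (fun=> a) a.
Proof. by apply/ccvgP => e e0; exists 0 => n _; rewrite subrr normr0 ltW. Qed.

Lemma ccvg_squeeze u l v m :
  (forall n, `|v n - m| <= `|u n - l|) -> ccvg u l -> ccvg v m.
Proof. exact: (@cvgn_squeeze _ R[i]^o R[i]^o). Qed.

Lemma ccvgD u v l m : ccvg u l -> ccvg v m -> ccvg (fun n => u n + v n) (l + m).
Proof. exact: (@cvgD _ R[i]^o). Qed.

Lemma ccvgB u v l m : ccvg u l -> ccvg v m -> ccvg (fun n => u n - v n) (l - m).
Proof. exact: (@cvgB _ R[i]^o). Qed.

Lemma ccvgM u v l m : ccvg u l -> ccvg v m -> ccvg (fun n => u n * v n) (l * m).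
Proof. exact: (@cvgZ _ R[i]^o). Qed.

Lemma ccvg_conj u l : ccvg u l -> ccvg (fun n => (u n)^*) l^*.
Proof. by apply: ccvg_squeeze => n; rewrite -rmorphB /= norm_conjC. Qed.

Lemma ccvg_norm u l : ccvg u l -> ccvg (fun n => `|u n|) `|l|.
Proof. by apply: ccvg_squeeze => n; exact: ler_dist_dist. Qed.

Lemma ccvg_ge0 u l : (forall n, 0 <= u n) -> ccvg u l -> 0 <= l.
Proof.
move=> u0 ul; rewrite (ccvg_uniq ul (_ : ccvg u `|l|))//.
by apply: ccvg_squeeze (ccvg_norm ul) => n; rewrite (ger0_norm (u0 n)).
Qed.

Lemma ccvg_le u v l m :
  (forall n, u n <= v n) -> ccvg u l -> ccvg v m -> l <= m.
Proof.
move=> uv ul vm; rewrite -subr_ge0; apply: ccvg_ge0 (ccvgB vm ul) => n.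
by rewrite subr_ge0.
Qed.

Lemma ccvg_shift k u l : ccvg u l -> ccvg (fun n => u (k + n)%N) l.
Proof.
move=> /ccvgP ul; apply/ccvgP => e /ul[N uN]; exists N => n Nn; apply: uN.
exact: leq_trans (leq_addl _ _).
Qed.

Lemma sqrr_ccvg u a l :
  (forall n, 0 <= u n) -> 0 <= l -> ccvg u a -> ccvg (fun n => u n ^+ 2) (l ^+ 2) ->
  ccvg u l.
Proof.
move=> u0 l0 ua ul2; suff -> : l = a by [].
apply/eqP; rewrite -(@eqrXn2 _ 2)//; last exact: ccvg_ge0 u0 ua.
by apply/eqP/(ccvg_uniq ul2); rewrite expr2; exact: ccvgM.
Qed.

End ComplexConvergence.

Arguments ccvg_cst {R} a.

(** * Positive semidefinite forms and inner products *)

Section PositiveForms.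
Variables (C : numClosedFieldType) (V : lmodType C).
Implicit Type B : V -> V -> C.

(** Degenerate forms are allowed: the Cauchy-Schwarz inequality is needed for
    the limit form on asymptotic orbits and for the defect [P^*^n P^n - J^* J],
    neither of which need be definite. *)
Definition psd_form B : Prop :=
  [/\ forall a x y z, B (a *: x + y) z = a * B x z + B y z,
      forall x y, B y x = (B x y)^* & forall x, 0 <= B x x].

Section Theory.
Variable B : V -> V -> C.
Hypothesis psdB : psd_form B.

Lemma psd_linl a x y z : B (a *: x + y) z = a * B x z + B y z.
Proof. by have [] := psdB. Qed.

Lemma psd_sym x y : B y x = (B x y)^*.
Proof. by have [] := psdB. Qed.

Lemma psd_ge0 x : 0 <= B x x.
Proof. by have [] := psdB. Qed.

Lemma psd_linr a x y z : B z (a *: x + y) = a^* * B z x + B z y.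
Proof. by rewrite psd_sym psd_linl rmorphD rmorphM /= -!psd_sym. Qed.

Lemma psd_sqnormD a x y :
  B (a *: x + y) (a *: x + y) =
  `|a| ^+ 2 * B x x + a * B x y + a^* * B y x + B y y.
Proof. by rewrite psd_linl !psd_linr normCK; ring. Qed.

Lemma psd_Cauchy_Schwarz x y : `|B x y| ^+ 2 <= B x x * B y y.
Proof.
have ge0 a := psd_ge0 (a *: y + x).
have key a : 0 <= `|a| ^+ 2 * B y y + a * B y x + a^* * B x y + B x x.
  by rewrite -psd_sqnormD.
have [y0|yN0] := eqVneq (B y y) 0.
  have [->|xyN0] := eqVneq (B x y) 0.
    by rewrite normr0 expr0n /= mulr_ge0 ?psd_ge0.
  (* the quadratic polynomial degenerates to an affine one, which is negative
     far out unless its slope vanishes *)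
  have n2 : 0 < `|B x y| ^+ 2 by rewrite exprn_gt0 ?normr_gt0.
  pose t := (B x x + 1) / (`|B x y| ^+ 2 * 2).
  have tR : t^* = t.
    by apply/CrealP; rewrite ger0_real// divr_ge0 ?addr_ge0 ?psd_ge0 ?mulr_ge0.
  have := key (- t * B x y).
  rewrite y0 mulr0 add0r rmorphM rmorphN /= tR (psd_sym x y).
  rewrite -!mulrA (mulrC (B x y)^*) -!normCK.
  have -> : - t * `|B x y| ^+ 2 + - t * `|B x y| ^+ 2 + B x x = -1.
    by rewrite /t; field; rewrite gt_eqF ?normr_gt0.
  by rewrite ler0N1.
(* evaluate the polynomial at its minimum *)
have y_gt0 : 0 < B y y by rewrite lt_def yN0 psd_ge0.
have := key (- (B x y / B y y)).
have yR : (B y y)^* = B y y by rewrite -psd_sym.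
rewrite normrN normrM normfV (ger0_norm (psd_ge0 y)) rmorphN rmorphM /= fmorphV /=.
rewrite yR (psd_sym x y).
have -> : (`|B x y| / B y y) ^+ 2 * B y y + - (B x y / B y y) * (B x y)^*
  + - ((B x y)^* / B y y) * B x y + B x x = (B x x * B y y - `|B x y| ^+ 2) / B y y.
  have E := normCK (B x y); rewrite expr_div_n E; by field; rewrite yN0.
by rewrite pmulr_lge0 ?invr_gt0// subr_ge0.
Qed.

End Theory.
End PositiveForms.

(** Expanding the squares of [x + y] and of ['i *: x + y] determines the sum and
    the difference of [B (f x) (f y)] and [B (f y) (f x)]. *)
Lemma polarization (C : numClosedFieldType) (V W : lmodType C)
    (A : V -> V -> C) (B : W -> W -> C) (f : {linear V -> W}) :
  psd_form A -> psd_form B ->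
  (forall x, B (f x) (f x) = A x x) -> forall x y, B (f x) (f y) = A x y.
Proof.
move=> psdA psdB fAB x y.
have eq a : a * B (f x) (f y) + a^* * B (f y) (f x) = a * A x y + a^* * A y x.
  have := fAB (a *: x + y); rewrite linearP (psd_sqnormD psdB) !fAB.
  rewrite (psd_sqnormD psdA) => h; apply: (addrI (`|a| ^+ 2 * A x x)).
  by apply: (addIr (A y y)); rewrite !addrA.
have := eq 'i; have := eq 1; rewrite conjCi conjC1 !mul1r => sum.
rewrite !mulNr -!mulrBr => /(mulfI (neq0Ci C)) diff.
have two : (2 : C) != 0 by rewrite pnatr_eq0.
have double (z w : C) : 2 * z = (z + w) + (z - w) by ring.
by apply: (mulfI two); rewrite (double _ (B (f y) (f x))) sum diff -double.
Qed.

Section Hilbert.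
Variable R : realType.
Implicit Types H K : hilbertType R.

Lemma inner_psd H : psd_form (inner : H -> H -> R[i]).
Proof.
split=> [a x y z|x y|x]; first by rewrite linearPl.
  by rewrite hermC expr0 mul1r.
by rewrite -sqr_norm_inner exprn_ge0.
Qed.

Lemma Cauchy_Schwarz H (x y : H) : `|inner x y| <= `|x| * `|y|.
Proof.
rewrite -ler_sqr ?nnegrE ?mulr_ge0// exprMn !sqr_norm_inner.
exact: psd_Cauchy_Schwarz (inner_psd H) x y.
Qed.

Lemma innerDl H (x y z : H) : inner (x + y) z = inner x z + inner y z.
Proof. exact: linearDl. Qed.

Lemma innerBl H (x y z : H) : inner (x - y) z = inner x z - inner y z.
Proof. exact: linearBl. Qed.

Lemma innerDr H (x y z : H) : inner z (x + y) = inner z x + inner z y.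
Proof. exact: linearDr. Qed.

Lemma innerBr H (x y z : H) : inner z (x - y) = inner z x - inner z y.
Proof. exact: linearBr. Qed.

Lemma innerZl H a (x y : H) : inner (a *: x) y = a * inner x y.
Proof. exact: linearZl_LR. Qed.

Lemma innerZr H a (x y : H) : inner x (a *: y) = a^* * inner x y.
Proof. exact: linearZr_LR. Qed.

Lemma inner0r H (z : H) : inner z 0 = 0.
Proof. exact: linear0r. Qed.

Lemma innerC H (x y : H) : inner x y = (inner y x)^*.
Proof. exact: psd_sym (inner_psd H) y x. Qed.

Lemma inner_eq0 H (x : H) : inner x x = 0 -> x = 0.
Proof. by rewrite -sqr_norm_inner => /eqP; rewrite sqrf_eq0 normr_eq0 => /eqP. Qed.

Lemma inner_inj H (x y : H) : (forall z, inner z x = inner z y) -> x = y.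
Proof.
by move=> xy; apply/eqP; rewrite -subr_eq0; apply/eqP/inner_eq0; rewrite innerBr xy subrr.
Qed.

Lemma norm_inner_eq H K (x : H) (y : K) : inner x x = inner y y -> `|x| = `|y|.
Proof.
by rewrite -!sqr_norm_inner => /eqP; rewrite eqrXn2// => /eqP.
Qed.

Lemma cvgn_innerl H (u : nat -> H) (l y : H) :
  u @ \oo --> l -> ccvg (fun n => inner (u n) y) (inner l y).
Proof.
move=> /cvgn_leP ul; apply/ccvgP => e e0.
have y1 : 0 < `|y| + 1 by rewrite ltr_wpDl.
have [N uN] := ul _ (divr_gt0 e0 y1); exists N => n /uN un.
rewrite -innerBl (le_trans (Cauchy_Schwarz _ _))//.
rewrite (le_trans (ler_wpM2r _ un))// mulrAC ler_pdivrMr//.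
by rewrite ler_wpM2l ?(ltW e0)// lerDl.
Qed.

Lemma cvgn_normP H (u : nat -> H) (l : H) :
  u @ \oo --> l -> ccvg (fun n => `|u n|) `|l|.
Proof.
move=> /cvgn_leP ul; apply/ccvgP => e /ul[N uN].
by exists N => n /uN; apply: le_trans; rewrite ler_dist_dist.
Qed.

End Hilbert.

(** * Orthogonal projection on a closed subspace *)

Section Projection.
Variables (R : realType) (H : hilbertType R).

Lemma parallelogram (x y : H) :
  `|x + y| ^+ 2 + `|x - y| ^+ 2 = 2 * (`|x| ^+ 2 + `|y| ^+ 2).
Proof.
rewrite !sqr_norm_inner innerBl !innerBr innerDl !innerDr.
set a := inner x x; set b := inner x y; set c := inner y x; set d := inner y y.
ring.
Qed.

Variable M : set H.
Hypothesis M_closed : closed_subspace M.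

Lemma subspaceD (x y : H) : M x -> M y -> M (x + y).
Proof. by have [_ _ lin] := M_closed => Mx My; rewrite -[x]scale1r; exact: lin. Qed.

Lemma subspaceZ a (x : H) : M x -> M (a *: x).
Proof. by have [_ M0 lin] := M_closed => Mx; rewrite -[_ *: _]addr0; exact: lin. Qed.

Lemma subspaceB (x y : H) : M x -> M y -> M (x - y).
Proof. by move=> Mx My; rewrite -scaleN1r; apply/subspaceD/subspaceZ. Qed.

Lemma subspace_lim (u : nat -> H) (l : H) :
  (forall n, M (u n)) -> u @ \oo --> l -> M l.
Proof.
have [cM _ _] := M_closed => Mu ul.
by apply: (closed_cvg M cM _ _ ul); exists 0.
Qed.

Lemma minimizing_seq (x : H) : exists d : R[i], exists u : nat -> H,
  [/\ forall m, M m -> d <= `|x - m| ^+ 2, forall n, M (u n)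
    & forall n, `|x - u n| ^+ 2 <= d + n.+1%:R^-1].
Proof.
pose D := [set complex.Re (`|x - m| ^+ 2) | m in M].
have sqE m : `|x - m| ^+ 2 = ((complex.Re (`|x - m| ^+ 2))%:C)%C.
  by rewrite RRe_real ?ger0_real ?exprn_ge0.
have D_inf : has_inf D.
  split; first by exists (complex.Re (`|x - 0| ^+ 2)), 0 => //; case: M_closed.
  by exists 0 => _ [m _ <-]; rewrite -lecR -sqE exprn_ge0.
have near n : exists m, M m /\ `|x - m| ^+ 2 <= ((inf D)%:C)%C + n.+1%:R^-1.
  have n0 : 0 < n.+1%:R^-1 :> R by rewrite invr_gt0 ltr0n.
  have [_ [m Mm <-] mlt] := inf_adherent n0 D_inf.
  exists m; split => //; rewrite sqE.
  have -> : n.+1%:R^-1 = ((n.+1%:R^-1 : R)%:C)%C :> R[i] by rewrite fmorphV rmorph_nat.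
  by rewrite -rmorphD lecR ltW.
have [u uP] := choice near.
exists ((inf D)%:C)%C, u; split=> [m Mm|n|n]; try by have [] := uP n.
rewrite sqE lecR; apply: ge_inf; [by case: D_inf|by exists m].
Qed.

(** The parallelogram law makes a minimizing sequence [u] for the distance to
    [M] converge.  Comparing [u n] with its best modification along [y] bounds
    [|<x - u n, y>|^2] by [|y|^2 / (n + 1)], so the limit is orthogonal to
    every [y] in [M]. *)
Lemma orthogonal_projection (x : H) :
  exists2 m, M m & orthocomplement M (x - m).
Proof.
have [d [u [d_le Mu ud]]] := minimizing_seq x.
have uC : cauchy_seq u.
  move=> e e0; have e4 : 0 < e ^+ 2 / 4 by rewrite divr_gt0 ?exprn_gt0.
  have [N NP] := invn_small e4; exists N => m n Nm Nn.
  rewrite -ler_sqr ?nnegrE ?(ltW e0)//.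
  have := parallelogram (x - u m) (x - u n).
  have -> : x - u m - (x - u n) = u n - u m.
    by rewrite opprB addrC addrA subrK.
  have -> : x - u m + (x - u n) = 2 *: (x - (2^-1 *: (u m + u n))).
    rewrite scalerBr scalerA divff ?pnatr_eq0// scale1r scaler_nat mulr2n.
    by rewrite addrACA opprD.
  rewrite normrZ exprMn normr_nat [`|u n - u m|]distrC => pE.
  have le_d : d <= `|x - 2^-1 *: (u m + u n)| ^+ 2.
    by apply: d_le; apply/subspaceZ/subspaceD; exact: Mu.
  have um := le_trans (ud m) (lerD (lexx d) (NP _ Nm)).
  have un := le_trans (ud n) (lerD (lexx d) (NP _ Nn)).
  have -> : `|u m - u n| ^+ 2 = 2 * (`|x - u m| ^+ 2 + `|x - u n| ^+ 2)
     - 2 ^+ 2 * `|x - 2^-1 *: (u m + u n)| ^+ 2 by rewrite -pE addrAC subrr add0r.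
  rewrite lerBlDr (le_trans (ler_wpM2l _ (lerD um un)))//.
  have -> : 2 * (d + e ^+ 2 / 4 + (d + e ^+ 2 / 4)) = e ^+ 2 + 2 ^+ 2 * d by field.
  by rewrite lerD2l ler_wpM2l.
have [m um] := cauchy_seq_cvgn uC.
have Mm := subspace_lim Mu um; exists m => // y My.
rewrite innerC; apply/eqP; rewrite conjC_eq0; apply/eqP.
have key n : `|inner (x - u n) y| ^+ 2 <= n.+1%:R^-1 * `|y| ^+ 2.
  have [->|yN0] := eqVneq y 0.
    by rewrite inner0r !normr0 expr0n /= mulr0.
  have y0 : 0 < `|y| ^+ 2 by rewrite exprn_gt0 ?normr_gt0.
  (* [u n + a *: y] is the point nearest to [x] on the line of direction [y] *)
  pose a := inner (x - u n) y / `|y| ^+ 2.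
  have := d_le (u n + a *: y); rewrite opprD addrA => /(_ _) dle.
  have {}dle := dle (subspaceD (Mu n) (subspaceZ a My)).
  have yE : `|y| ^+ 2 = inner y y by exact: sqr_norm_inner.
  have yR : (`|y| ^+ 2)^* = `|y| ^+ 2.
    by apply/CrealP; rewrite ger0_real// exprn_ge0.
  have E : `|x - u n - a *: y| ^+ 2 =
      `|x - u n| ^+ 2 - `|inner (x - u n) y| ^+ 2 / `|y| ^+ 2.
    rewrite addrC -scaleNr sqr_norm_inner (psd_sqnormD (inner_psd H)).
    rewrite -!sqr_norm_inner (innerC y) rmorphN /a rmorphM fmorphV /= yR.
    rewrite normrN normrM normfV (ger0_norm (ltW y0)) expr_div_n.
    rewrite (normCK (inner (x - u n) y)); field.
    by rewrite normr_eq0 yN0.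
  move: dle; rewrite E lerBrDr => dle.
  by rewrite -ler_pdivrMr// -(lerD2l d) (le_trans dle).
have lim : ccvg (fun n => inner (x - u n) y) (inner (x - m) y).
  apply: cvgn_innerl; apply: cvgn_squeeze um => n.
  by rewrite opprB addrC addrA subrK distrC.
have lim0 : ccvg (fun n => inner (x - u n) y) 0.
  apply/ccvgP => e e0.
  have y1 : 0 < `|y| ^+ 2 + 1 by rewrite ltr_wpDl// exprn_ge0.
  have [N NP] := invn_small (divr_gt0 (exprn_gt0 2 e0) y1).
  exists N => n /NP nN; rewrite subr0 -ler_sqr ?nnegrE ?(ltW e0)//.
  rewrite (le_trans (key n))// (le_trans (ler_wpM2r _ nN)) ?exprn_ge0//.
  rewrite mulrAC ler_pdivrMr// ler_wpM2l ?exprn_ge0 ?(ltW e0)// lerDl//.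
exact: (ccvg_uniq lim lim0).
Qed.

End Projection.

(** * Adjoints and unitary operators *)

Section Operators.
Variable R : realType.
Implicit Types H K L : hilbertType R.

Lemma bounded_op_ge0 H K (A : H -> K) : bounded_op A ->
  exists2 M : R[i], 0 <= M & forall x, `|A x| <= M * `|x|.
Proof.
move=> [M AM]; exists `|M| => // x.
rewrite (le_trans (AM x))// -[leLHS]ger0_norm ?(le_trans _ (AM x))//.
by rewrite normrM normr_id.
Qed.

(** The kernel of [f] is a closed subspace; unless it is everything, a vector
    orthogonal to it represents [f] up to a scalar. *)
Lemma Riesz_representation H (f : {linear H -> R[i]^o}) (M : R[i]) :
  0 <= M -> (forall x, `|f x| <= M * `|x|) ->
  exists z, forall x, f x = inner x z.
Proof.
move=> M0 fM; pose N := [set x | f x = 0].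
have N_closed : closed_subspace N.
  split=> [||a x y]; rewrite /N /= ?linear0//; last first.
    by rewrite linearP => -> ->; rewrite scaler0 addr0.
  apply: closed_approxP => x apx; apply/eqP/negPn/negP => fx0.
  have M1 : 0 < M + 1 by rewrite ltr_wpDl.
  have [|y fy xy] := apx (`|f x| / (M + 1)); first by rewrite divr_gt0 ?normr_gt0.
  have : `|f x| <= M * (`|f x| / (M + 1)).
    rewrite -[X in `|X| <= _](subr0) -{1}fy -linearB (le_trans (fM _))//.
    by rewrite ler_wpM2l.
  rewrite mulrA ler_pdivlMr// mulrDr mulr1 [M * _]mulrC gerDl.
  by rewrite real_leNgt// normr_gt0 fx0.
have [f0|/existsNP[x0 /eqP fx0]] := pselect (forall x, f x = 0).
  by exists 0 => x; rewrite f0 inner0r.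
have [m Nm orth] := orthogonal_projection N_closed x0.
pose w := x0 - m.
have fw : f w != 0 by rewrite linearB Nm subr0.
have w0 : inner w w != 0.
  by apply: contraNneq fw => /inner_eq0 ->; rewrite linear0.
exists ((f w / inner w w)^* *: w) => x.
have Nx : N (x - (f x / f w) *: w).
  by rewrite /N /= linearB linearZ /= /GRing.scale /= divfK// subrr.
have := orth _ Nx; rewrite -/w innerBl innerZl => /eqP.
rewrite subr_eq0 => /eqP xw; rewrite innerZr conjCK xw.
by field; rewrite fw w0.
Qed.

(** Boundedness matters here: [adjoint] is defined by choice, and the vector that
    it should choose exists by Riesz representation. *)
Lemma adjointE H K (A : {linear H -> K}) : bounded_op A ->
  forall x y, inner (A x) y = inner x (adjoint A y).
Proof.
move=> /bounded_op_ge0[M M0 AM] x y.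
have f_lin : linear (fun x => inner (A x) y : R[i]^o).
  by move=> a u v; rewrite linearP innerDl innerZl.
pose f : {linear H -> R[i]^o} := HB.pack (fun x => inner (A x) y : R[i]^o)
  (GRing.isLinear.Build _ _ _ _ _ f_lin).
have [||z fz] := @Riesz_representation _ f (M * `|y|); first exact: mulr_ge0.
  move=> u; rewrite (le_trans (Cauchy_Schwarz _ _))// mulrAC ler_wpM2r//.
rewrite /adjoint; case: xgetP => [z' _ /(_ x)//|/(_ z)].
by case => u; exact: fz.
Qed.

Lemma contraction_bounded H K (A : H -> K) : contraction_op A -> bounded_op A.
Proof. by move=> Ac; exists 1 => x; rewrite mul1r. Qed.

Lemma adjoint_adjoint H K (A : {linear H -> K}) : bounded_op A ->
  adjoint (adjoint A) = A.
Proof.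
move=> /adjointE Aadj; apply: adjoint_eq => x y.
by rewrite innerC -Aadj -innerC.
Qed.

Lemma unitary_inner H K (U : {linear H -> K}) : unitary_op U ->
  forall x y, inner (U x) (U y) = inner x y.
Proof. by move=> [/adjointE Uadj UK _] x y; rewrite Uadj UK. Qed.

Lemma isometry_inner H K (U : {linear H -> K}) :
  (forall x, `|U x| = `|x|) -> forall x y, inner (U x) (U y) = inner x y.
Proof.
move=> Uiso; apply: polarization (inner_psd H) (inner_psd K) _ => x.
by rewrite -!sqr_norm_inner Uiso.
Qed.

(** An isometry preserves inner products, so any right inverse of it is its
    adjoint. *)
Lemma isometry_onto_unitary H K (U : {linear H -> K}) :
  (forall x, `|U x| = `|x|) -> (forall y, exists x, U x = y) -> unitary_op U.
Proof.
move=> Uiso /choice[V UV].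
have adjU : adjoint U = V.
  by apply: adjoint_eq => x y; rewrite -{1}(UV y) isometry_inner.
have Uinj : injective U.
  move=> x y xy; apply/eqP; rewrite -subr_eq0 -normr_eq0 -Uiso linearB xy.
  by rewrite subrr normr0.
split; first by apply: contraction_bounded => x; rewrite Uiso.
  by rewrite adjU => x; apply: Uinj; rewrite UV.
by rewrite adjU.
Qed.

Lemma unitary_isometry H K (U : {linear H -> K}) : unitary_op U ->
  forall x, `|U x| = `|x|.
Proof. by move=> /unitary_inner UE x; apply: norm_inner_eq; rewrite UE. Qed.

Lemma unitary_inverse H K (U : {linear H -> K}) : unitary_op U ->
  exists V : {linear K -> H}, [/\ adjoint U = V, forall y, `|V y| = `|y|,
    cancel U V & cancel V U].
Proof.
move=> Uu; have [_ UK KU] := Uu.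
have V_lin : linear (adjoint U).
  by move=> a x y; apply: (can_inj UK); rewrite linearP !KU.
pose V : {linear K -> H} :=
  HB.pack (adjoint U) (GRing.isLinear.Build _ _ _ _ _ V_lin).
exists V; split=> // y.
by rewrite -(unitary_isometry Uu (V y)) /= KU.
Qed.

Lemma isometry_range_closed H K (W : {linear H -> K}) :
  (forall x, `|W x| = `|x|) -> closed (range W).
Proof.
move=> Wiso; apply: closed_approxP => y apx.
have /choice[x xP] : forall n, exists x, `|y - W x| <= n.+1%:R^-1.
  move=> n; have [|_ [x _ <-] yx] := apx n.+1%:R^-1; first by rewrite invr_gt0 ltr0n.
  by exists x.
have Wx : (fun n => W (x n)) @ \oo --> y.
  apply/cvgn_leP => e /invn_small[N NP]; exists N => n /NP; apply: le_trans.
  by rewrite distrC.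
have [|l xl] := @cauchy_seq_cvgn _ H x.
  move=> e /(cvgn_cauchy_seq Wx)[N NP]; exists N => m n Nm Nn.
  by rewrite -Wiso linearB NP.
exists l => //; apply: cvgn_uniq Wx.
by apply: cvgn_squeeze xl => n; rewrite -linearB Wiso.
Qed.

Lemma orthocomplement_meet H (M : set H) x : M x -> orthocomplement M x -> x = 0.
Proof. by move=> Mx /(_ _ Mx) /inner_eq0. Qed.

(** Split [adjoint U x] as [m + m'] along [M].  Then [U m' = x - U m] lies both in
    [M] and in its orthocomplement, so [m'] vanishes. *)
Lemma reduces_unitary_adjoint H (M : set H) (U : {linear H -> H}) :
  closed_subspace M -> unitary_op U -> reduces M U ->
  forall x, M x -> M (adjoint U x).
Proof.
move=> cM Uu [UM UMo] x Mx; have [_ UK KU] := Uu.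
have [m Mm om] := orthogonal_projection cM (adjoint U x).
have MUm : M (U m) by apply: UM; exists m.
have oU : orthocomplement M (U (adjoint U x - m)).
  by apply: UMo; exists (adjoint U x - m).
have : U (adjoint U x - m) = 0.
  apply: orthocomplement_meet oU; rewrite linearB KU.
  exact: subspaceB.
move=> /(congr1 (fun y => `|y|)); rewrite (unitary_isometry Uu) normr0.
by move=> /eqP; rewrite normr_eq0 subr_eq0 => /eqP ->.
Qed.

End Operators.

Section LinearFactor.
Variables (K : nzRingType) (V W X : lmodType K).

(** This lets operators on a quotient be defined on representatives. *)
Lemma linear_factor (p : {linear V -> W}) (f : {linear V -> X}) :
  (forall y, exists x, p x = y) -> (forall x, p x = 0 -> f x = 0) ->
  exists g : {linear W -> X}, forall x, g (p x) = f x.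
Proof.
move=> /choice[s ps] ker.
have fE x y : p x = p y -> f x = f y.
  move=> pxy; apply/eqP; rewrite -subr_eq0 -linearB; apply/eqP/ker.
  by rewrite linearB pxy subrr.
have g_lin : linear (f \o s).
  by move=> a x y /=; rewrite -linearP; apply: fE; rewrite linearP !ps.
pose g : {linear W -> X} :=
  HB.pack (f \o s) (GRing.isLinear.Build _ _ _ _ _ g_lin).
by exists g => x /=; exact/fE/ps.
Qed.

End LinearFactor.

(** * The Hilbert space separated from a complete semidefinite form *)

(** Completeness is expressed with the values of the form, squares of the
    seminorm, so as to need no topology on the space before separation. *)
Record semiHilbert (R : realType) := SemiHilbert {
  semi_space :> lmodType R[i];
  semi_form : semi_space -> semi_space -> R[i];
  semi_psd : psd_form semi_form;
  semi_complete : forall u : nat -> semi_space,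
    (forall e : R[i], 0 < e -> exists N, forall m n, (N <= m)%N -> (N <= n)%N ->
       semi_form (u m - u n) (u m - u n) <= e) ->
    exists l, forall e : R[i], 0 < e -> exists N, forall n, (N <= n)%N ->
       semi_form (u n - l) (u n - l) <= e }.

Section Separation.
Variables (R : realType) (S : semiHilbert R).
Notation B := (@semi_form R S).

(** A vector [x] is encoded by the functional [B x]: by the Cauchy-Schwarz inequality
    two vectors have the same functional exactly when they differ by a null
    vector.  The quotient by null vectors is thus a submodule of a module of
    functions, and inherits its operations. *)
Definition represented : {pred S -> R[i]^o} :=
  [pred f | `[< exists x, f = B x >]].

Lemma represented_submod : submod_closed represented.
Proof.
split.
  apply/asboolP; exists 0; apply/funext => y.
  have := psd_linl (semi_psd S) (-1) 0 0 y.
  by rewrite scaler0 addr0 mulN1r addNr => ->.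
move=> a f g /asboolP[x ->] /asboolP[y ->]; apply/asboolP.
exists (a *: x + y); apply/funext => z.
by rewrite (psd_linl (semi_psd S)).
Qed.

HB.instance Definition _ :=
  GRing.isSubmodClosed.Build _ _ represented represented_submod.

Record separated := Separated {
  functional :> S -> R[i]^o;
  functional_represented : functional \in represented }.

HB.instance Definition _ := [isSub for functional].
HB.instance Definition _ := [Choice of separated by <:].
HB.instance Definition _ := [SubChoice_isSubLmodule of separated by <:].

Lemma functionalP (f : separated) : exists x, functional f = B x.
Proof. by apply/asboolP; exact: functional_represented. Qed.

Definition sep_lift (f : separated) : S := sval (cid (functionalP f)).

Lemma sep_liftE f : functional f = B (sep_lift f).
Proof. exact: svalP (cid (functionalP f)). Qed.

Lemma sep_class_proof (x : S) : (B x : S -> R[i]^o) \in represented.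
Proof. by apply/asboolP; exists x. Qed.

Definition sep_class (x : S) : separated := Separated (sep_class_proof x).

Lemma sep_liftK f : sep_class (sep_lift f) = f.
Proof. by apply: val_inj; rewrite /= sep_liftE. Qed.

Lemma sep_class_linear : linear sep_class.
Proof.
move=> a x y; apply: val_inj; rewrite linearP /=; apply/funext => z.
exact: psd_linl (semi_psd S) a x y z.
Qed.

HB.instance Definition _ := GRing.isLinear.Build _ _ _ _ sep_class sep_class_linear.

Definition sep_inner (f g : separated) : R[i] := B (sep_lift f) (sep_lift g).

Lemma sep_inner_class x y : sep_inner (sep_class x) (sep_class y) = B x y.
Proof.
have E z : B (sep_lift (sep_class z)) = B z by rewrite -sep_liftE.
rewrite /sep_inner E (psd_sym (semi_psd S)) E.
by rewrite -(psd_sym (semi_psd S)).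
Qed.

Lemma sep_ind (P : separated -> Prop) : (forall x, P (sep_class x)) -> forall f, P f.
Proof. by move=> Pc f; rewrite -(sep_liftK f). Qed.

Lemma sep_inner_psd : psd_form sep_inner.
Proof.
split=> [a f g h|f g|f].
- elim/sep_ind: f => x; elim/sep_ind: g => y; elim/sep_ind: h => z.
  by rewrite -linearP !sep_inner_class (psd_linl (semi_psd S)).
- exact: psd_sym (semi_psd S) _ _.
- exact: psd_ge0 (semi_psd S) _.
Qed.

Lemma sep_inner_eq0 f : sep_inner f f = 0 -> f = 0.
Proof.
move=> f0; apply: val_inj; rewrite /= sep_liftE; apply/funext => y; apply/eqP.
rewrite -normr_eq0 -sqrf_eq0 eq_le exprn_ge0// andbT.
rewrite (le_trans (psd_Cauchy_Schwarz (semi_psd S) _ _))//.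
by rewrite [B (sep_lift f) _]f0 mul0r.
Qed.

Lemma sep_inner_bilinear : bilinear_for *%R (Num.conj \; *%R) sep_inner.
Proof.
split=> [h a f g|h a f g] /=; first exact: (psd_linl sep_inner_psd).
exact: (psd_linr sep_inner_psd).
Qed.

HB.instance Definition _ := bilinear_isBilinear.Build _ _ _ _ _ _ sep_inner
  sep_inner_bilinear.

Lemma sep_inner_hermitian f g :
  sep_inner f g = (-1) ^+ false * (sep_inner g f)^*.
Proof. by rewrite expr0 mul1r -(psd_sym sep_inner_psd). Qed.

HB.instance Definition _ := isHermitianSesquilinear.Build _ _ _ _ sep_inner
  sep_inner_hermitian.

Lemma sep_inner_gt0 f : f != 0 -> 0 < sep_inner f f.
Proof.
move=> f0; rewrite lt_def (psd_ge0 sep_inner_psd) andbT.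
by apply: contra_neq f0; exact: sep_inner_eq0.
Qed.

HB.instance Definition _ := isDotProduct.Build _ _ sep_inner sep_inner_gt0.

Definition sep_norm (f : separated) : R[i] := sqrtC (sep_inner f f).

Lemma sep_norm_sqr f : sep_norm f ^+ 2 = sep_inner f f.
Proof. exact: sqrtCK. Qed.

Lemma sep_norm_ge0 f : 0 <= sep_norm f.
Proof. by rewrite sqrtC_ge0 (psd_ge0 sep_inner_psd). Qed.

Lemma sep_normD f g : sep_norm (f + g) <= sep_norm f + sep_norm g.
Proof.
rewrite -ler_sqr ?nnegrE ?addr_ge0 ?sep_norm_ge0// sqrrD !sep_norm_sqr.
have := psd_sqnormD sep_inner_psd 1 f g.
rewrite scale1r normr1 expr1n conjC1 !mul1r => ->.
rewrite !addrA lerD2r -!addrA lerD2l (psd_sym sep_inner_psd f g).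
have CS : `|sep_inner f g| <= sep_norm f * sep_norm g.
  rewrite -ler_sqr ?nnegrE ?mulr_ge0 ?sep_norm_ge0// exprMn !sep_norm_sqr.
  exact: psd_Cauchy_Schwarz sep_inner_psd f g.
have re : sep_inner f g + (sep_inner f g)^* \is Num.real.
  by apply/CrealP; rewrite rmorphD /= conjCK addrC.
rewrite (le_trans (real_ler_norm re))// (le_trans (ler_normD _ _))//.
by rewrite norm_conjC lerD.
Qed.

Lemma sep_normZ (a : R[i]) f : sep_norm (a *: f) = `|a| * sep_norm f.
Proof.
apply/eqP; rewrite -(@eqrXn2 _ 2) ?mulr_ge0 ?sep_norm_ge0//.
rewrite exprMn !sep_norm_sqr; have := psd_sqnormD sep_inner_psd a f 0.
have f0 h : sep_inner h 0 = 0 by exact: linear0r.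
by rewrite addr0 !f0 (psd_sym sep_inner_psd f 0) f0 conjC0 !mulr0 !addr0 => ->.
Qed.

Lemma sep_norm_eq0 f : sep_norm f = 0 -> f = 0.
Proof. by move=> f0; apply: sep_inner_eq0; rewrite -sep_norm_sqr f0 expr0n. Qed.

HB.instance Definition _ := Lmodule_isNormed.Build R[i] separated
  sep_normD sep_normZ sep_norm_eq0.

Lemma sep_normE (f : separated) : `|f| = sep_norm f.
Proof. by []. Qed.

End Separation.

(** A Cauchy filter contains a ball of radius [1 / (n + 1)] for every [n]; any two
    of them meet, so the centres form a Cauchy sequence, and the filter
    converges to the limit of that sequence. *)
Lemma complete_from_seq (R : realType) (V : normedModType R[i]) :
  (forall u : nat -> V, cauchy_seq u -> exists l : V, u @ \oo --> l) ->
  forall F : set_system V, ProperFilter F -> cauchy F -> cvg F.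
Proof.
move=> seq_complete F FF /cauchyP Fc.
have /choice[u uF] : forall n, exists x : V, F (ball x (n.+1%:R^-1 : R[i])).
  by move=> n; apply: Fc; rewrite invr_gt0 ltr0n.
have meet m n : `|u m - u n| <= m.+1%:R^-1 + n.+1%:R^-1.
  have [x []] := @filter_ex _ F _ _ (filterI (uF m) (uF n)).
  rewrite -!ball_normE /= => um un.
  by rewrite (le_trans (ler_distD x _ _))// lerD// ?(ltW um)// distrC ltW.
have [|l ul] := seq_complete u.
  move=> e e0; have e2 : 0 < e / 2 by rewrite divr_gt0.
  have [N NP] := invn_small e2; exists N => m n Nm Nn.
  by rewrite (le_trans (meet m n))// (splitr e) lerD ?NP.
apply/cvg_ex; exists l; apply/cvgrPdist_le => e e0.
have e2 : 0 < e / 2 by rewrite divr_gt0.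
have [N NP] := invn_small e2; have [N' uN'] := (cvgn_leP _ _).1 ul _ e2.
pose n := maxn N N'; near=> x.
have : ball (u n) n.+1%:R^-1 x by near: x; exact: uF.
rewrite -ball_normE /= => /ltW ux.
rewrite (le_trans (ler_distD (u n) _ _))// (splitr e) lerD//.
  by rewrite distrC uN'// leq_maxr.
by rewrite (le_trans ux)// NP// leq_maxl.
Unshelve. all: by end_near. Qed.

Section SeparatedHilbert.
Variables (R : realType) (S : semiHilbert R).

Lemma separated_complete (F : set_system (separated S)) :
  ProperFilter F -> cauchy F -> cvg F.
Proof.
apply: complete_from_seq => u uC; pose v n := sep_lift (u n).
have uE n : u n = sep_class (v n) by rewrite sep_liftK.
have distE x y : `|sep_class x - sep_class y : separated S| ^+ 2 =
    semi_form (x - y) (x - y).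
  by rewrite -linearB /= sep_normE sep_norm_sqr sep_inner_class.
have [|l lP] := @semi_complete _ S v.
  move=> e e0; have e1 : 0 < sqrtC e by rewrite sqrtC_gt0.
  have [N NP] := uC _ e1; exists N => m n Nm Nn.
  rewrite -distE -!uE -[leRHS]sqrtCK ler_sqr ?nnegrE ?(ltW e1)//.
  exact: NP.
exists (sep_class l); apply/cvgn_leP => e e0.
have [N NP] := lP _ (exprn_gt0 2 e0); exists N => n /NP.
by rewrite -distE -uE ler_sqr ?nnegrE ?(ltW e0).
Qed.

HB.instance Definition _ := Uniform_isComplete.Build (separated S)
  separated_complete.

Lemma separated_sqr_norm (f : separated S) : `|f| ^+ 2 = sep_inner f f.
Proof. exact: sep_norm_sqr. Qed.

HB.instance Definition _ := isHilbert.Build R (separated S) separated_sqr_norm.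

End SeparatedHilbert.

Lemma separation (R : realType) (S : semiHilbert R) :
  exists (K : hilbertType R) (p : {linear S -> K}),
    (forall y, exists x, p x = y) /\
    forall x y, inner (p x) (p y) = semi_form x y.
Proof.
exists (separated S), (@sep_class R S); split=> [f|x y].
  by exists (sep_lift f); exact: sep_liftK.
exact: sep_inner_class.
Qed.

(** * Asymptotic orbits of a contraction *)

Lemma iter_linear (K : nzRingType) (V : lmodType K) (f : {linear V -> V}) n :
  linear (iter n f).
Proof. by move=> a x y; elim: n => // n IH; rewrite !iterS IH linearP. Qed.

HB.instance Definition _ (K : nzRingType) (V : lmodType K) (f : {linear V -> V}) n :=
  GRing.isLinear.Build _ _ _ _ (iter n f) (iter_linear f n).

Lemma iter_contraction (R : realType) (H : hilbertType R) (f : H -> H) n :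
  contraction_op f -> contraction_op (iter n f).
Proof.
by move=> fc; elim: n => [|n IH] x //=; rewrite (le_trans (fc _)).
Qed.

Lemma iter_isometry (R : realType) (H : hilbertType R) (f : {linear H -> H}) n :
  (forall x, `|f x| = `|x|) -> forall x, `|iter n f x| = `|x|.
Proof. by move=> fiso x; elim: n => //= n IH; rewrite fiso. Qed.

Lemma iter_commute (X : Type) (f g : X -> X) :
  (forall x, g (f x) = f (g x)) -> forall n x, g (iter n f x) = iter n f (g x).
Proof. by move=> fg; elim=> // n IH x; rewrite !iterS fg IH. Qed.

Lemma iter_cancel (X : Type) (f g : X -> X) n :
  cancel f g -> cancel (iter n f) (iter n g).
Proof. by move=> fK x; elim: n => // n IH; rewrite (iterSr n g) (iterS n f) fK. Qed.

(** The index [kappa n] is the largest [k <= n] that is usable at time [n], where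
    [k] is usable from time [M k] on; it tends to infinity with [n]. *)
Lemma diagonal_index (M : nat -> nat) :
  exists kappa : nat -> nat, forall k n, (k <= n)%N -> (M k <= n)%N ->
    (k <= kappa n)%N /\ (M (kappa n) <= n)%N.
Proof.
exists (fun n => \max_(j < n.+1 | (M j <= n)%N) j) => k n kn Mk; split.
  exact: (@leq_bigmax_cond _ _ _ (Ordinal (kn : (k < n.+1)%N))).
have [|i Mi ->] := @eq_bigmax_cond _ [pred j : 'I_n.+1 | (M j <= n)%N] (fun j => j).
  by apply/card_gt0P; exists (Ordinal (kn : (k < n.+1)%N)).
exact: Mi.
Qed.

Section AsymptoticOrbits.
Variables (R : realType) (H : hilbertType R) (P : {linear H -> H}).
Hypothesis P_contr : contraction_op P.

(** The closeness is required after every [k >= N], not only for [k = N]: this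
    makes the condition stable under linear combinations and shifts, and gives
    directly that the norms are almost decreasing. *)
Definition asymptotic (x : nat -> H) : Prop :=
  forall e : R[i], 0 < e -> exists N, forall k n, (N <= k)%N ->
    `|x (n + k)%N - iter n P (x k)| <= e.

Definition asymptotic_pred : {pred nat -> H} := [pred x | `[< asymptotic x >]].

Lemma asymptotic_submod : submod_closed asymptotic_pred.
Proof.
split.
  apply/asboolP => e e0; exists 0 => k n _.
  by rewrite [iter _ _ _](linear0 (iter n P)) subrr normr0 ltW.
move=> a x y /asboolP ax /asboolP ay; apply/asboolP => e e0.
have e2 : 0 < e / 2 by rewrite divr_gt0.
have a1 : 0 < `|a| + 1 by rewrite ltr_wpDl.
have [N1 xN] := ax _ (divr_gt0 e2 a1); have [N2 yN] := ay _ e2.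
exists (maxn N1 N2) => k n; rewrite geq_max => /andP[/(xN k n) xk /(yN k n) yk].
rewrite [iter _ _ _](linearP (iter n P)) /= opprD addrACA -scalerBr.
rewrite (le_trans (ler_normD _ _))// (splitr e) lerD// normrZ.
rewrite (le_trans (ler_wpM2l _ xk))// mulrA ler_pdivrMr// mulrC ler_wpM2l ?(ltW e2)//.
by rewrite lerDl.
Qed.

HB.instance Definition _ :=
  GRing.isSubmodClosed.Build _ _ asymptotic_pred asymptotic_submod.

Record asymptotic_orbit := Orbit {
  orbit_seq :> nat -> H;
  orbit_mem : orbit_seq \in asymptotic_pred }.

HB.instance Definition _ := [isSub for orbit_seq].
HB.instance Definition _ := [Choice of asymptotic_orbit by <:].
HB.instance Definition _ := [SubChoice_isSubLmodule of asymptotic_orbit by <:].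

Lemma orbitP (x : asymptotic_orbit) : asymptotic x.
Proof. by apply/asboolP; exact: orbit_mem. Qed.

Lemma orbit_linE a (x y : asymptotic_orbit) n : (a *: x + y) n = a *: x n + y n.
Proof. by []. Qed.

Lemma orbit_subE (x y : asymptotic_orbit) n : (x - y) n = x n - y n.
Proof. by []. Qed.

Definition mk_orbit (x : nat -> H) (hx : asymptotic x) : asymptotic_orbit :=
  @Orbit x (introT (asboolP _) hx).

Lemma orbit_norm_cvg (x : asymptotic_orbit) : exists l, ccvg (fun n => `|x n|) l.
Proof.
apply: complex_cauchy_cvgn; apply: almost_noninc_cauchy_seq => // e e0.
have [N xN] := orbitP x e0; exists N => k n Nk.
rewrite -(subrK (iter n P (x k)) (x _)) addrC (le_trans (ler_normD _ _))//.
by rewrite lerD ?xN// iter_contraction.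
Qed.

Definition orbit_form (x y : asymptotic_orbit) : R[i] :=
  xget 0 [set l | ccvg (fun n => inner (x n) (y n)) l].

(** By polarization it is enough that the squared norms of [x], of [y] and of
    [a *: x + y] converge, and these sequences are all asymptotic orbits. *)
Lemma orbit_form_cvg (x y : asymptotic_orbit) :
  ccvg (fun n => inner (x n) (y n)) (orbit_form x y).
Proof.
rewrite /orbit_form; case: xgetP => // noLim; exfalso.
have diag (z : asymptotic_orbit) : exists l, ccvg (fun n => inner (z n : H) (z n : H)) l.
  have [l zl] := orbit_norm_cvg z; exists (l * l).
  have := ccvgM zl zl; congr ccvg; apply/funext => n.
  by rewrite -sqr_norm_inner.
have polar u v a : a * inner (u : H) v + a^* * inner v u = inner (a *: u + v) (a *: u + v)
    - `|a| ^+ 2 * inner u u - inner v v.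
  by rewrite (psd_sqnormD (inner_psd H)); ring.
have half a : exists l, ccvg (fun n => a * inner (x n) (y n) + a^* * inner (y n) (x n)) l.
  have [lxy cxy] := diag (a *: x + y); have [lx cx] := diag x; have [ly cy] := diag y.
  exists (lxy - `|a| ^+ 2 * lx - ly).
  have := ccvgB (ccvgB cxy (ccvgM (ccvg_cst (`|a| ^+ 2)) cx)) cy.
  by congr ccvg; apply/funext => n; rewrite polar.
have [l1 c1] := half 1; have [li ci] := half 'i.
apply: (noLim ((l1 - 'i * li) / 2)) => /=.
have := ccvgM (ccvgB c1 (ccvgM (ccvg_cst 'i) ci)) (ccvg_cst 2^-1).
congr ccvg; apply/funext => n; rewrite conjC1 conjCi !mul1r.
have i2 : 'i * 'i = -1 :> R[i] by rewrite -expr2 sqrCi.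
rewrite mulrDr mulNr mulrN !mulrA i2; by field.
Qed.

Arguments orbit_form_cvg x y : clear implicits.

Lemma orbit_formP (x y : asymptotic_orbit) l :
  ccvg (fun n => inner (x n) (y n)) l -> orbit_form x y = l.
Proof. by move=> h; apply: ccvg_uniq h; exact: orbit_form_cvg. Qed.

Lemma orbit_form_psd : psd_form orbit_form.
Proof.
split=> [a x y z|x y|x].
- apply: orbit_formP.
  have := ccvgD (ccvgM (ccvg_cst a) (orbit_form_cvg x z)) (orbit_form_cvg y z).
  by congr ccvg; apply/funext => n; rewrite orbit_linE innerDl innerZl.
- apply: orbit_formP; have := ccvg_conj (orbit_form_cvg x y).
  by congr ccvg; apply/funext => n; rewrite -innerC.
- apply: ccvg_ge0 (orbit_form_cvg x x) => n.
  by rewrite -sqr_norm_inner exprn_ge0.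
Qed.

Lemma orbit_form_eventually (x : asymptotic_orbit) (e : R[i]) : 0 < e ->
  exists N, forall n, (N <= n)%N -> `|x n| ^+ 2 <= orbit_form x x + e.
Proof.
move=> /((ccvgP _ _).1 (orbit_form_cvg x x))[N xN]; exists N => n /xN.
rewrite -sqr_norm_inner => h; rewrite -lerBlDl (le_trans _ h)// real_ler_norm//.
rewrite rpredB// ger0_real ?exprn_ge0//; exact: psd_ge0 orbit_form_psd _.
Qed.

Lemma eventually_orbit_form (x : asymptotic_orbit) (c : R[i]) :
  (exists N, forall n, (N <= n)%N -> `|x n| ^+ 2 <= c) -> orbit_form x x <= c.
Proof.
move=> [N xN]; apply: ccvg_le (ccvg_shift N (orbit_form_cvg x x)) (ccvg_cst c).
by move=> n; rewrite -sqr_norm_inner xN// leq_addr.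
Qed.

(** The iterates of [P] do not increase distances, so the defining estimate
    passes from [x] to a sequence that is eventually close to it. *)
Lemma close_asymptotic (y : nat -> H) :
  (forall e : R[i], 0 < e ->
     exists x : asymptotic_orbit, exists N, forall n, (N <= n)%N ->
     `|y n - x n| <= e) -> asymptotic y.
Proof.
move=> close e e0; have e3 : 0 < e / 3 by rewrite divr_gt0.
have [x [N1 yx]] := close _ e3; have [N2 xP] := orbitP x e3.
exists (maxn N1 N2) => k n; rewrite geq_max => /andP[N1k N2k].
have -> : y (n + k)%N - iter n P (y k) = (y (n + k)%N - x (n + k)%N) +
    (x (n + k)%N - iter n P (x k)) - iter n P (y k - x k).
  by rewrite [iter n P (_ - _)](linearB (iter n P)) /= !subrKA opprB addrA subrK.
have -> : e = e / 3 + e / 3 + e / 3 by field.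
rewrite (le_trans (ler_normB _ _))// lerD//.
  rewrite (le_trans (ler_normD _ _))// lerD ?xP//.
  exact/yx/(leq_trans N1k)/leq_addl.
by rewrite (le_trans (iter_contraction n P_contr _))// yx.
Qed.

(** Diagonal argument: let [y n] be the [n]-th term of [u (kappa n)], where
    [kappa] grows slowly enough that, at time [n], the distance from the terms
    of [u (kappa n)] to those of every earlier [u k] is already controlled by
    the form. *)
Lemma orbit_form_complete (u : nat -> asymptotic_orbit) :
  (forall e : R[i], 0 < e -> exists N, forall m n, (N <= m)%N -> (N <= n)%N ->
     orbit_form (u m - u n) (u m - u n) <= e) ->
  exists l, forall e : R[i], 0 < e -> exists N, forall n, (N <= n)%N ->
     orbit_form (u n - l) (u n - l) <= e.
Proof.
move=> uC.
have /choice[M MP] : forall j, exists M, forall k n, (k <= j)%N -> (M <= n)%N ->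
    `|u j n - u k n| ^+ 2 <= orbit_form (u j - u k) (u j - u k) + j.+1%:R^-1.
  move=> j; have j0 : 0 < j.+1%:R^-1 :> R[i] by rewrite invr_gt0 ltr0n.
  have /choice[N NP] k := orbit_form_eventually (u j - u k) j0.
  exists (\max_(k < j.+1) N k) => k n kj Nn; apply: NP; apply: leq_trans Nn.
  exact: (leq_bigmax (Ordinal (kj : (k < j.+1)%N))).
have [kappa kP] := diagonal_index M.
pose y n := u (kappa n) n.
have yP (e : R[i]) : 0 < e -> exists K, forall k, (K <= k)%N ->
    exists N, forall n, (N <= n)%N -> `|y n - u k n| ^+ 2 <= e.
  move=> e0; have e2 : 0 < e / 2 by rewrite divr_gt0.
  have [K1 uK] := uC _ e2; have [K2 inv] := invn_small e2.
  exists (maxn K1 K2) => k; rewrite geq_max => /andP[K1k K2k].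
  exists (maxn k (M k)) => n; rewrite geq_max => /andP[kn Mn].
  (* now [k <= kappa n], so [MP] compares [u (kappa n)] with [u k] at time [n] *)
  have [kk Mk] := kP _ _ kn Mn.
  rewrite (le_trans (MP _ _ _ kk Mk))// (splitr e) lerD//.
    by rewrite uK// (leq_trans K1k).
  by rewrite inv// (leq_trans K2k).
have y_asym : asymptotic y.
  apply: close_asymptotic => e e0; have [K KP] := yP _ (exprn_gt0 2 e0).
  have [N NP] := KP K (leqnn K); exists (u K), N => n /NP.
  by rewrite ler_sqr ?nnegrE ?(ltW e0).
exists (mk_orbit y_asym) => e e0; have [K KP] := yP e e0.
exists K => k /KP[N NP]; apply: eventually_orbit_form; exists N => n /NP.
by rewrite distrC orbit_subE.
Qed.

End AsymptoticOrbits.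

Lemma asymptotic_completion (R : realType) (H : hilbertType R)
    (P : {linear H -> H}) : contraction_op P ->
  exists (K : hilbertType R) (p : {linear asymptotic_orbit P -> K}),
    (forall y, exists x, p x = y) /\
    forall x y : asymptotic_orbit P,
      ccvg (fun n => inner (x n) (y n)) (inner (p x) (p y)).
Proof.
move=> Pc.
have [K [p [p_onto p_inner]]] := separation (SemiHilbert (orbit_form_psd Pc)
  (orbit_form_complete Pc)).
exists K, p; split=> // x y; rewrite p_inner; exact: orbit_form_cvg.
Qed.

(** * Products of commuting tuples *)

Section Tuples.
Variable R : realType.
Implicit Types H K : hilbertType R.

(** Products over arbitrary lists of indices, so that facts about [product_op]
    can be proved by induction on the enumeration of ['I_d]. *)
Definition seq_product H d (T : 'I_d -> {linear H -> H}) (r : seq 'I_d) : H -> H :=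
  \big[(fun A B : H -> H => A \o B) / id]_(i <- r) (T i : H -> H).

Lemma seq_product_cons H d (T : 'I_d -> {linear H -> H}) i r x :
  seq_product T (i :: r) x = T i (seq_product T r x).
Proof. by rewrite /seq_product big_cons. Qed.

Lemma seq_product_nil H d (T : 'I_d -> {linear H -> H}) x :
  seq_product T [::] x = x.
Proof. by rewrite /seq_product big_nil. Qed.

Section Tuple.
Variables (H : hilbertType R) (d : nat) (T : 'I_d -> {linear H -> H}).

Lemma product_op_linear : linear (product_op T).
Proof.
rewrite -[product_op T]/(seq_product T _); elim: index_enum => [|i r IH] a x y.
  by rewrite !seq_product_nil.
by rewrite !seq_product_cons IH linearP.
Qed.

HB.instance Definition _ := GRing.isLinear.Build _ _ _ _ (product_op T) product_op_linear.

Lemma product_op_contraction :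
  (forall i, contraction_op (T i)) -> contraction_op (product_op T).
Proof.
move=> Tc; rewrite -[product_op T]/(seq_product T _).
elim: index_enum => [|i r IH] x; first by rewrite seq_product_nil.
by rewrite seq_product_cons (le_trans (Tc _ _)).
Qed.

Lemma product_op_commute : commuting T ->
  forall j x, T j (product_op T x) = product_op T (T j x).
Proof.
move=> TC j; rewrite -[product_op T]/(seq_product T _).
elim: index_enum => [|i r IH] x; first by rewrite !seq_product_nil.
by rewrite !seq_product_cons TC IH.
Qed.

(** [S] is the product with one occurrence of [T i] left out. *)
Lemma product_op_factor : commuting T -> (forall i, contraction_op (T i)) ->
  forall i, exists S : H -> H, [/\ contraction_op S,
    forall x, product_op T x = T i (S x) & forall x, product_op T x = S (T i x)].
Proof.
move=> TC Tc i.
suff [S [Sc SC SP]] : exists S : H -> H, [/\ contraction_op S,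
    forall j x, T j (S x) = S (T j x) & forall x, product_op T x = T i (S x)].
  by exists S; split=> // x; rewrite SP SC.
rewrite -[product_op T]/(seq_product T _).
elim: index_enum (mem_index_enum i) => // j r IH.
have prodC k x : T k (seq_product T r x) = seq_product T r (T k x).
  elim: (r) x => [|l s IHs] x; first by rewrite !seq_product_nil.
  by rewrite !seq_product_cons TC IHs.
rewrite inE; have [<- _|_ /= /IH[S [Sc SC SP]]] := eqVneq i j.
  exists (seq_product T r); split=> [|//|x]; last by rewrite seq_product_cons.
  elim: (r) => [|k s IHs] x; first by rewrite seq_product_nil.
  by rewrite seq_product_cons (le_trans (Tc _ _)).
exists (T j \o S); split=> [x|k x|x] /=.
- exact: le_trans (Tc _ _) (Sc _).
- by rewrite TC SC.
- by rewrite seq_product_cons SP TC.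
Qed.

(** With [S] the product of the other operators,
    [|x| = |S (T i x)| <= |T i x| <= |x|], and [T i] is onto because
    [T i (S x)] is. *)
Lemma unitary_of_product : commuting T -> (forall i, contraction_op (T i)) ->
  (forall x, `|product_op T x| = `|x|) -> (forall y, exists x, product_op T x = y) ->
  forall i, unitary_op (T i).
Proof.
move=> TC Tc Piso Ponto i; have [S [Sc PTS PST]] := product_op_factor TC Tc i.
apply: isometry_onto_unitary => [x|y].
  by apply/eqP; rewrite eq_le Tc /= -[leLHS]Piso PST Sc.
by have [x <-] := Ponto y; exists (S x); rewrite -PTS.
Qed.

Lemma product_op_unitary : (forall i, unitary_op (T i)) -> unitary_op (product_op T).
Proof.
move=> Tu; suff [iso onto] : (forall x, `|product_op T x| = `|x|) /\
    forall y, exists x, product_op T x = y by exact: isometry_onto_unitary.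
rewrite -[product_op T]/(seq_product T _).
elim: index_enum => [|i r [iso onto]].
  by split=> x; [|exists x]; rewrite seq_product_nil.
split=> x; first by rewrite seq_product_cons (unitary_isometry (Tu i)).
have [_ _ TK] := Tu i; have [y yP] := onto (adjoint (T i) x).
by exists y; rewrite seq_product_cons yP.
Qed.

Lemma product_op_reduces (M : set H) :
  (forall i, reduces M (T i)) -> reduces M (product_op T).
Proof.
move=> red; rewrite -[product_op T]/(seq_product T _).
elim: index_enum => [|i r [IH IHo]].
  by split=> _ [x Mx <-]; rewrite seq_product_nil.
have [TM TMo] := red i.
split=> _ [x Mx <-]; rewrite seq_product_cons.
  by apply: TM; exists (seq_product T r x) => //; apply: IH; exists x.
by apply: TMo; exists (seq_product T r x) => //; apply: IHo; exists x.
Qed.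

End Tuple.

Lemma product_op_intertwine H K d (T : 'I_d -> {linear H -> H})
    (U : 'I_d -> {linear K -> K}) (J : H -> K) :
  (forall j x, J (T j x) = U j (J x)) ->
  forall x, J (product_op T x) = product_op U (J x).
Proof.
move=> JTU x; rewrite -[product_op T]/(seq_product T _) -[product_op U]/(seq_product U _).
elim: index_enum => [|i r IH]; first by rewrite !seq_product_nil.
by rewrite !seq_product_cons JTU IH.
Qed.

Lemma iter_adjointE H (A : {linear H -> H}) n : bounded_op A ->
  forall x y, inner (iter n A x) y = inner x (iter n (adjoint A) y).
Proof.
move=> /adjointE Aadj; elim: n => // n IH x y.
by rewrite iterS Aadj IH -iterSr.
Qed.

(** * Canonicity in terms of norms *)

Section StrongLimit.
Variables (H K : hilbertType R) (P : {linear H -> H}) (J : {linear H -> K}).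
Hypotheses (P_contr : contraction_op P) (J_contr : contraction_op J).

(** Pair the strong limit with [x]. *)
Lemma norm_iter_SOT :
  SOT_cvg (fun n => iter n (adjoint P) \o iter n P) (adjoint J \o J) ->
  forall x, ccvg (fun n => `|iter n P x| ^+ 2) (`|J x| ^+ 2).
Proof.
move=> sot x; have := cvgn_innerl (y := x) (sot x).
rewrite innerC -(adjointE (contraction_bounded J_contr)) -innerC -sqr_norm_inner.
congr ccvg; apply/funext => n /=.
rewrite innerC -(iter_adjointE n (contraction_bounded P_contr)) -innerC.
by rewrite sqr_norm_inner.
Qed.

(** The form [B u v] of the operator [P^*^n P^n - J^* J] lies between [0] and the
    inner product.  With [D] the image of [x] under that operator, the
    Cauchy-Schwarz inequality [|B x D|^2 <= B x x * B D D] reads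
    [|D|^4 <= B x x * |D|^2], and [B x x = |P^n x|^2 - |J x|^2] tends to [0]. *)
Lemma SOT_of_norm_iter :
  (forall n x, `|J x| <= `|iter n P x|) ->
  (forall x, ccvg (fun n => `|iter n P x| ^+ 2) (`|J x| ^+ 2)) ->
  SOT_cvg (fun n => iter n (adjoint P) \o iter n P) (adjoint J \o J).
Proof.
move=> JleP PJ x; apply/cvgn_leP => e e0.
have [N NP] := (ccvgP _ _).1 (PJ x) _ (exprn_gt0 2 e0); exists N => n /NP /= small.
pose B u v := inner (iter n P u) (iter n P v) - inner (J u) (J v).
have psdB : psd_form B.
  split=> [a u v w|u v|u]; rewrite /B.
  - rewrite [iter n P (_ + _)](linearP (iter n P)) /= (linearP J) !innerDl !innerZl.
    by ring.
  - by rewrite rmorphB /= -!innerC.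
  - by rewrite -!sqr_norm_inner subr_ge0 ler_sqr ?nnegrE.
pose D := iter n (adjoint P) (iter n P x) - adjoint J (J x).
have DB v : inner D v = B x v.
  rewrite /D /B innerBl; congr (_ - _); rewrite innerC.
    by rewrite -(iter_adjointE n (contraction_bounded P_contr)) -innerC.
  by rewrite -(adjointE (contraction_bounded J_contr)) -innerC.
have BDD : B D D <= `|D| ^+ 2.
  rewrite /B -!sqr_norm_inner lerBlDr (@le_trans _ _ (`|D| ^+ 2))//.
    by rewrite ler_sqr ?nnegrE// iter_contraction.
  by rewrite lerDl exprn_ge0.
rewrite -[_ - _]/D; have [->|D0] := eqVneq D 0; first by rewrite normr0 ltW.
have D2 : 0 < `|D| ^+ 2 by rewrite exprn_gt0 ?normr_gt0.
have := psd_Cauchy_Schwarz psdB x D.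
rewrite -DB -sqr_norm_inner ger0_norm ?exprn_ge0// => CS.
rewrite -ler_sqr ?nnegrE ?(ltW e0)// -(ler_pM2r D2) -expr2 (le_trans CS)//.
rewrite ler_pM ?(psd_ge0 psdB)// (le_trans _ small)//.
by rewrite /B -!sqr_norm_inner real_ler_norm// ger0_real// !sqr_norm_inner (psd_ge0 psdB).
Qed.

End StrongLimit.
End Tuples.

Arguments norm_iter_SOT {R H K P J} P_contr J_contr sot x : rename.

(** * The model on classes of asymptotic orbits *)

Section AsymptoticModel.
Variables (R : realType) (H : hilbertType R) (d : nat).
Variable T : 'I_d -> {linear H -> H}.
Hypotheses (T_comm : commuting T) (T_contr : forall i, contraction_op (T i)).

Let P : {linear H -> H} := product_op T.
Let P_contr : contraction_op P := product_op_contraction T_contr.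

Variables (K : hilbertType R) (p : {linear asymptotic_orbit P -> K}).
Hypotheses (p_onto : forall y, exists x, p x = y)
  (p_inner : forall x y : asymptotic_orbit P,
     ccvg (fun n => inner (x n) (y n)) (inner (p x) (p y))).
Arguments p_inner : clear implicits.

Lemma class_norm (x : asymptotic_orbit P) : ccvg (fun n => `|x n|) `|p x|.
Proof.
have [l xl] := orbit_norm_cvg P_contr x.
apply: sqrr_ccvg xl _ => //.
rewrite sqr_norm_inner; have := p_inner x x; congr ccvg; apply/funext => n.
by rewrite sqr_norm_inner.
Qed.

Arguments class_norm x : clear implicits.

Lemma class_close (x y : asymptotic_orbit P) (e : R[i]) :
  (exists N, forall n, (N <= n)%N -> `|x n - y n| <= e) -> `|p x - p y| <= e.
Proof.
move=> [N xy]; rewrite -linearB.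
apply: ccvg_le (ccvg_shift N (class_norm (x - y))) (ccvg_cst e) => n.
by rewrite orbit_subE xy// leq_addr.
Qed.

Lemma class_eq (x y : asymptotic_orbit P) :
  (forall e, 0 < e -> exists N, forall n, (N <= n)%N -> `|x n - y n| <= e) ->
  p x = p y.
Proof.
move=> xy; apply/eqP; rewrite -subr_eq0 -normr_le0.
have [//|pos] := real_leP (normr_real _) (real0 R[i]).
have e2 : 0 < `|p x - p y| / 2 by rewrite divr_gt0.
have := class_close (xy _ e2).
by rewrite -subr_ge0 {2}(splitr `|p x - p y|) opprD addrA subrr add0r oppr_ge0 lt_geF.
Qed.

(** In the limit, applying [P] termwise and shifting to the left agree on
    asymptotic orbits. *)
Lemma class_shift (x y : asymptotic_orbit P) : (forall n, y n = P (x n)) ->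
  forall z : asymptotic_orbit P, (forall n, z n = x n.+1) -> p y = p z.
Proof.
move=> yE z zE; apply: class_eq => e /(orbitP x)[N xN]; exists N => n Nn.
by rewrite yE zE distrC -addn1 addnC; exact: (xN n 1).
Qed.

Lemma shift_asymptotic (x : asymptotic_orbit P) : asymptotic P (fun n => x n.+1).
Proof.
move=> e /(orbitP x)[N xN]; exists N => k n Nk.
by rewrite -addnS xN// (leq_trans Nk).
Qed.

(** The right shift, with the first term repeated, represents the inverse of the
    left shift on classes. *)
Lemma unshift_asymptotic (x : asymptotic_orbit P) : asymptotic P (fun n => x n.-1).
Proof.
move=> e /(orbitP x)[N xN]; exists N.+1 => -[//|k] n Nk.
by rewrite addnS /= xN.
Qed.

Lemma push_asymptotic (S : {linear H -> H}) (x : asymptotic_orbit P) :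
  contraction_op S -> (forall x, S (P x) = P (S x)) -> asymptotic P (fun n => S (x n)).
Proof.
move=> Sc SP e /(orbitP x)[N xN]; exists N => k n Nk.
by rewrite -iter_commute// -linearB (le_trans (Sc _))// xN.
Qed.

(** A contraction commuting with [P] acts termwise on asymptotic orbits without
    increasing the limit norm, hence acts on classes. *)
Lemma push_operator (S : {linear H -> H}) :
  contraction_op S -> (forall x, S (P x) = P (S x)) ->
  exists g : {linear K -> K}, contraction_op g /\
    forall x y : asymptotic_orbit P, (forall n, y n = S (x n)) -> g (p x) = p y.
Proof.
move=> Sc SP.
pose f x := p (mk_orbit (push_asymptotic x Sc SP)).
have f_lin : linear f.
  move=> a x y; rewrite /f -linearP; congr (p _); apply: val_inj.
  by apply/funext => n; rewrite /= linearP.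
pose F : {linear asymptotic_orbit P -> K} :=
  HB.pack f (GRing.isLinear.Build _ _ _ _ _ f_lin).
have F_le x : `|F x| <= `|p x|.
  by apply: ccvg_le (class_norm _) (class_norm x) => n /=; exact: Sc.
have [|g gE] := linear_factor (f := F) p_onto.
  by move=> x px; apply/eqP; rewrite -normr_le0 (le_trans (F_le x))// px normr0.
exists g; split=> [k|x y yE].
  by have [x <-] := p_onto k; rewrite gE.
rewrite gE; congr (p _); apply: val_inj; apply/funext => n /=.
by rewrite yE.
Qed.

Lemma T_product_commute j x : T j (P x) = P (T j x).
Proof. exact: product_op_commute. Qed.

Lemma orbit_of_asymptotic (x : H) : asymptotic P (fun n => iter n P x).
Proof.
by move=> e e0; exists 0 => k n _; rewrite iterD subrr normr0 ltW.
Qed.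

(** Genuine orbits embed [H] in the model, up to vectors with [P^n x] tending to
    [0]. *)
Definition model_map (x : H) : K := p (mk_orbit (orbit_of_asymptotic x)).

Lemma model_map_linear : linear model_map.
Proof.
move=> a x y; rewrite /model_map -linearP; congr (p _); apply: val_inj.
by apply/funext => n; rewrite /= -[iter n P _]/(_ (_ + _)) (linearP (iter n P)).
Qed.

HB.instance Definition _ := GRing.isLinear.Build _ _ _ _ model_map model_map_linear.

Lemma model_map_norm x : ccvg (fun n => `|iter n P x|) `|model_map x|.
Proof. exact: class_norm. Qed.

Arguments model_map_norm x : clear implicits.

Variable U : 'I_d -> {linear K -> K}.
Hypotheses (U_contr : forall j, contraction_op (U j))
  (U_class : forall j (x y : asymptotic_orbit P),
     (forall n, y n = T j (x n)) -> U j (p x) = p y).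

Lemma U_push j (x : asymptotic_orbit P) :
  U j (p x) = p (mk_orbit (push_asymptotic x (T_contr j) (T_product_commute j))).
Proof. exact: U_class. Qed.

Lemma model_commuting : commuting U.
Proof.
move=> i j k; have [x <-] := p_onto k; rewrite !U_push.
by congr (p _); apply: val_inj; apply/funext => n /=; exact: T_comm.
Qed.

Lemma model_intertwine j x : model_map (T j x) = U j (model_map x).
Proof.
rewrite /model_map U_push; congr (p _); apply: val_inj; apply/funext => n /=.
by rewrite iter_commute// => z; exact: T_product_commute.
Qed.

Lemma model_product (x y : asymptotic_orbit P) : (forall n, y n = P (x n)) ->
  product_op U (p x) = p y.
Proof.
suff gen (r : seq 'I_d) : exists2 z : asymptotic_orbit P,
    (forall n, z n = seq_product T r (x n)) & seq_product U r (p x) = p z.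
  have [z zE Uz] := gen (index_enum 'I_d) => yE.
  transitivity (p z); first exact: Uz.
  by congr (p _); apply: val_inj; apply/funext => n /=; rewrite zE yE.
elim: r => [|i r [z zE Uz]].
  by exists x => [n|]; rewrite seq_product_nil.
exists (mk_orbit (push_asymptotic z (T_contr i) (T_product_commute i))) => [n|] /=.
  by rewrite seq_product_cons zE.
by rewrite seq_product_cons Uz U_push.
Qed.

Lemma model_product_shift (x z : asymptotic_orbit P) : (forall n, z n = x n.+1) ->
  product_op U (p x) = p z.
Proof.
move=> zE.
rewrite (model_product (y := mk_orbit (push_asymptotic x P_contr (fun=> erefl))))//.
exact: class_shift zE.
Qed.

Lemma model_product_isometry k : `|product_op U k| = `|k|.
Proof.
have [x <-] := p_onto k.
rewrite (model_product_shift (z := mk_orbit (shift_asymptotic x)))//.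
have := ccvg_shift 1 (class_norm x); apply: ccvg_uniq.
exact: (class_norm (mk_orbit (shift_asymptotic x))).
Qed.

(** The product is the left shift on classes, so the right shift of [x] is
    mapped to [x]. *)
Lemma model_product_onto k : exists k', product_op U k' = k.
Proof.
have [x <-] := p_onto k; exists (p (mk_orbit (unshift_asymptotic x))).
exact: model_product_shift.
Qed.

Lemma model_unitary j : unitary_op (U j).
Proof.
exact: unitary_of_product model_commuting U_contr model_product_isometry
  model_product_onto j.
Qed.

Lemma iter_model_product k (x z : asymptotic_orbit P) : (forall n, z n = x (n + k)%N) ->
  iter k (product_op U) (p x) = p z.
Proof.
elim: k x z => [|k IH] x z zE.
  by congr (p _); apply: val_inj; apply/funext => n /=; rewrite zE addn0.
rewrite iterSr (model_product_shift (z := mk_orbit (shift_asymptotic x)))//.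
by apply: IH => n /=; rewrite zE addnS.
Qed.

(** The [k]-th power of the product shifts [x] by [k] places, and from place [k] on
    [x] is close to the genuine orbit of [x k].  Applying the inverse power, the
    class of [x] is the limit of the vectors [U_P^(-k) (J (x k))]. *)
Lemma model_approx (x : asymptotic_orbit P) (e : R[i]) : 0 < e ->
  exists N, forall k, (N <= k)%N ->
  `|iter k (product_op U) (p x) - model_map (x k)| <= e.
Proof.
move=> /(orbitP x)[N xN]; exists N => k Nk.
have z_asym : asymptotic P (fun n => x (n + k)%N).
  move=> e' /(orbitP x)[N' xN']; exists N' => l n Nl.
  by rewrite -addnA xN'// (leq_trans Nl)// leq_addr.
rewrite (iter_model_product (z := mk_orbit z_asym))//.
by apply: class_close; exists 0 => n _ /=; exact: xN.
Qed.

Let V : {linear K -> K} := product_op U.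

Let V_unitary : unitary_op V.
Proof. exact/product_op_unitary/model_unitary. Qed.

(** A closed subspace reducing the tuple is stable under the inverse of the
    product, so it contains the vectors [U_P^(-n) (J (x n))] and their limit,
    the class of [x]. *)
Lemma model_minimal (M : set K) : closed_subspace M ->
  (forall j, reduces M (U j)) -> range model_map `<=` M -> M = setT.
Proof.
move=> cM red JM; apply/seteqP; split=> // k _; have [x <-] := p_onto k.
have [V' [V'E V'iso VK KV]] := unitary_inverse V_unitary.
have stab y : M y -> M (V' y).
  rewrite -V'E; apply: (reduces_unitary_adjoint cM V_unitary).
  exact: product_op_reduces.
apply: (@subspace_lim _ _ M cM (fun n => iter n V' (model_map (x n)))) => [n|].
  have : M (model_map (x n)) by apply: JM; exists (x n).
  by move: (model_map _) => y My; elim: n => // m IH; exact: stab IH.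
apply/cvgn_leP => e /(model_approx x)[N NP]; exists N => n /NP; apply: le_trans.
rewrite distrC -(iter_isometry n (unitary_isometry V_unitary)).
rewrite [iter n V _](linearB (iter n V)) /=.
by rewrite (iter_cancel n KV).
Qed.

Lemma model_canonical : (exists x, model_map x <> 0) ->
  canonical_unitary_pseudo_extension T (Triple model_map U).
Proof.
move=> nz.
have J_le n x : `|model_map x| <= `|iter n P x|.
  apply: ccvg_le (ccvg_shift n (model_map_norm x)) (ccvg_cst `|iter n P x|) => m.
  by rewrite addnC iterD iter_contraction.
split; split.
- split => //=; [exact: model_commuting | | exact: J_le 0 | exact: model_intertwine].
  by move=> j; apply: contraction_bounded.
- exact: model_unitary.
- by move=> M cM red; exact: model_minimal.
- apply: (SOT_of_norm_iter (J := model_map) P_contr (J_le 0) J_le) => x.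
  exact: ccvgM (model_map_norm x) (model_map_norm x).
Qed.

Lemma model_norm_approx (x : asymptotic_orbit P) :
  ccvg (fun n => `|model_map (x n)|) `|p x|.
Proof.
apply/ccvgP => e /(model_approx x)[N NP]; exists N => n /NP; apply: le_trans.
rewrite distrC -[X in `|X - _|](iter_isometry n (unitary_isometry V_unitary)).
exact: ler_dist_dist.
Qed.

Arguments model_norm_approx x : clear implicits.

(** On the class of [x] the equivalence [W] is the limit of
    [V'^(-n) (J' (x n))], with [V'] the product of the given unitaries.  The
    sequence is Cauchy because [V'^(-n) J' P^n = J'], so that consecutive errors
    are those of the asymptotic orbit [x]. *)
Lemma model_universal (F : triple H d) :
  canonical_unitary_pseudo_extension T F ->
  unitarily_equivalent (Triple model_map U) F.
Proof.
case: F => K' J' U' [[[/= U'_comm _ J'_contr _ J'_int] /= U'_unitary]].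
move=> [/= F_min /= F_sot].
have J'_norm x : `|J' x| = `|model_map x|.
  have sq := norm_iter_SOT P_contr J'_contr F_sot x.
  exact: ccvg_uniq (sqrr_ccvg _ _ (model_map_norm x) sq) (model_map_norm x).
pose V' : {linear K' -> K'} := product_op U'.
have V'_unitary : unitary_op V' by exact: product_op_unitary.
have [B [_ Biso VB BV]] := unitary_inverse V'_unitary.
have J'_iter n x : J' (iter n P x) = iter n V' (J' x).
  by elim: n => // n IH; rewrite !iterS -IH; exact: product_op_intertwine.
have B_comm j y : B (U' j y) = U' j (B y).
  have V'C z : V' (U' j z) = U' j (V' z).
    by rewrite [RHS](product_op_commute U'_comm).
  by apply: (can_inj VB); rewrite BV V'C BV.
have B_iter_comm n j y : iter n B (U' j y) = U' j (iter n B y).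
  by elim: n => // n IH; rewrite !iterS IH B_comm.
pose a (x : asymptotic_orbit P) n := iter n B (J' (x n)).
have /choice[f fP] : forall x : asymptotic_orbit P, exists l : K', a x @ \oo --> l.
  move=> x; apply: cauchy_seq_cvgn => e e0.
  have e2 : 0 < e / 2 by rewrite divr_gt0.
  have [N xN] := orbitP x e2.
  have tail n : (N <= n)%N -> `|a x n - a x N| <= e / 2.
    move=> Nn; rewrite /a -{1}(subnK Nn) addnC iterD.
    have -> : J' (x N) = iter (n - N) B (J' (iter (n - N) P (x N))).
      by rewrite J'_iter (iter_cancel _ VB).
    rewrite -(linearB (iter N B)) (iter_isometry _ Biso).
    rewrite -(linearB (iter (n - N) B)) (iter_isometry _ Biso) -linearB.
    by rewrite (le_trans (J'_contr _))// -{1}(subnK Nn) xN.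
  exists N => m n Nm Nn; rewrite (le_trans (ler_distD (a x N) _ _))//.
  by rewrite (splitr e) lerD ?tail// distrC tail.
have f_lin : linear f.
  move=> c x y; apply: (cvgn_uniq (fP (c *: x + y))).
  have -> : a (c *: x + y) = (fun n => c *: a x n) + a y.
    apply/funext => n; rewrite /a orbit_linE linearP.
    exact: (linearP (iter n B)).
  exact: cvgD (cvgZl_tmp (fP x)) (fP y).
pose Fl : {linear asymptotic_orbit P -> K'} :=
  HB.pack f (GRing.isLinear.Build _ _ _ _ _ f_lin).
(* so [f] kills the null orbits, and factors through an isometry *)
have f_norm x : `|f x| = `|p x|.
  apply: ccvg_uniq (cvgn_normP (fP x)) _.
  have := model_norm_approx x; congr ccvg; apply/funext => n.
  by rewrite /a (iter_isometry _ Biso) J'_norm.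
have [|W WE] := linear_factor (f := Fl) p_onto.
  by move=> x px; apply/eqP; rewrite -normr_eq0 /= f_norm px normr0.
have Wiso k : `|W k| = `|k|.
  by have [x <-] := p_onto k; rewrite WE /= f_norm.
have WU j k : W (U j k) = U' j (W k).
  have [x <-] := p_onto k; rewrite U_push !WE /=; apply: (cvgn_uniq (fP _)).
  apply: cvgn_squeeze (fP x) => n; rewrite /a /= J'_int B_iter_comm -linearB.
  by rewrite (unitary_isometry (U'_unitary j)).
have WJ x : W (model_map x) = J' x.
  rewrite /model_map WE /=; apply: (cvgn_uniq (fP _)).
  apply/cvgn_leP => e e0; exists 0 => n _.
  by rewrite /a /= J'_iter (iter_cancel _ VB) subrr normr0 ltW.
exists W; split => //; apply: isometry_onto_unitary => // y.
(* surjectivity is where the minimality of the given pseudo-extension enters *)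
have rangeT : range W = setT.
  apply: F_min.
  - split; first exact: isometry_range_closed.
      by exists 0; rewrite ?linear0.
    by move=> c _ _ [u _ <-] [v _ <-]; exists (c *: u + v) => //; rewrite linearP.
  - move=> j; split; first by move=> _ [_ [k _ <-] <-]; exists (U j k).
    move=> _ [y' oy <-] _ [k _ <-].
    have [_ _ UK] := model_unitary j.
    rewrite -(UK k) WU (unitary_inner (U'_unitary j)); apply: oy.
    by exists (adjoint (U j) k).
  - by move=> _ [x _ <-]; exists (model_map x).
have [k _ <-] : range W y by rewrite rangeT.
by exists k.
Qed.

End AsymptoticModel.

(** * The three implications *)

Section Implications.
Variables (R : realType) (H : hilbertType R) (d : nat).
Variable T : 'I_d -> {linear H -> H}.
Hypotheses (T_comm : commuting T) (T_contr : forall i, contraction_op (T i)).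

Lemma toeplitz_product (A : H -> H) :
  (forall i x, adjoint (T i) (A (T i x)) = A x) ->
  forall x y, inner (A (product_op T x)) (product_op T y) = inner (A x) y.
Proof.
move=> At; rewrite -[product_op T]/(seq_product T _).
elim: index_enum => [|i r IH] x y; first by rewrite !seq_product_nil.
rewrite !seq_product_cons -[RHS]IH -(At i (seq_product T r x)) [RHS]innerC.
by rewrite -(adjointE (contraction_bounded (T_contr i))) -innerC.
Qed.

Lemma toeplitz_not_pure (A : {linear H -> H}) : toeplitz_ops T A ->
  (exists x, A x <> 0) -> ~ pure (adjoint (product_op T)).
Proof.
move=> [A_bounded At] [x Ax] pureP; apply: Ax.
have P_contr := product_op_contraction T_contr.
have [M M0 AM] := bounded_op_ge0 A_bounded.
move: pureP; rewrite /pure (adjoint_adjoint (contraction_bounded P_contr)) => pureP.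
have step n u v : inner (A (iter n (product_op T) u)) (iter n (product_op T) v)
    = inner (A u) v.
  by elim: n => // n IH; rewrite !iterS (toeplitz_product At).
apply: inner_eq0; rewrite innerC; set v := A x.
suff lim0 : ccvg (fun=> inner v v) 0.
  by rewrite (ccvg_uniq (ccvg_cst _) lim0) conjC0.
have M1 : 0 < M * `|v| + 1 by rewrite ltr_wpDl// mulr_ge0.
apply/ccvgP => e e0; have [N NP] := (cvgn_leP _ _).1 (pureP x) _ (divr_gt0 e0 M1).
exists N => n /NP; rewrite !subr0 => small.
rewrite -{1}/v -(step n x v) (le_trans (Cauchy_Schwarz _ _))//.
rewrite (@le_trans _ _ (M * `|iter n (product_op T) x| * `|v|))//.
  by rewrite ler_pM// iter_contraction.
rewrite mulrAC (le_trans (ler_wpM2l _ small)) ?mulr_ge0//.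
rewrite mulrCA ler_piMr ?(ltW e0)// ler_pdivrMr// mul1r lerDl//.
Qed.

(** The model is a pseudo-extension only if its map is nonzero, and the map
    vanishes at [x] exactly when [P^n x] tends to [0]. *)
Lemma not_pure_canonical : ~ pure (adjoint (product_op T)) ->
  exists E : triple H d, canonical_unitary_pseudo_extension T E /\
    forall F, canonical_unitary_pseudo_extension T F -> unitarily_equivalent E F.
Proof.
have P_contr := product_op_contraction T_contr.
rewrite /pure (adjoint_adjoint (contraction_bounded P_contr)).
move=> /existsNP[x0 nlim].
have [K [p [p_onto p_inner]]] := asymptotic_completion P_contr.
have /choice[U UP] j := push_operator T_contr p_onto p_inner (T_contr j)
  (T_product_commute T_comm j).
have U_contr j := (UP j).1; have U_class j := (UP j).2.
exists (Triple (model_map p) U); split.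
  apply: model_canonical => //; exists x0 => J0; apply: nlim.
  apply/cvgn_leP => e e0.
  have : ccvg (fun n => `|iter n (product_op T) x0|) `|model_map p x0|.
    exact: model_map_norm.
  rewrite J0 normr0 => /ccvgP /(_ e e0)[N NP]; exists N => n /NP.
  by rewrite !subr0 normr_id.
by move=> F; exact: model_universal.
Qed.

(** The operator is [J^* J]. *)
Lemma unitary_pseudo_extension_toeplitz (E : triple H d) :
  unitary_pseudo_extension T E ->
  exists A : {linear H -> H}, toeplitz_ops T A /\ exists x, A x <> 0.
Proof.
case: E => K J U [[/= _ _ J_contr [x Jx] JTU] /= U_unitary].
have Jadj := adjointE (contraction_bounded J_contr).
have A_lin : linear (adjoint J \o J).
  move=> a u v; apply: inner_inj => z.
  by rewrite innerDr innerZr /= -!Jadj linearP innerDr innerZr.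
pose A : {linear H -> H} :=
  HB.pack (adjoint J \o J) (GRing.isLinear.Build _ _ _ _ _ A_lin).
exists A; split; last first.
  exists x => /= Ax0; apply: Jx; apply: inner_eq0.
  by rewrite Jadj Ax0 inner0r.
split=> [|i u].
  exists 1 => u /=; rewrite mul1r.
  have [->|AN0] := eqVneq (adjoint J (J u)) 0; first by rewrite normr0.
  rewrite -(@ler_pM2l _ `|adjoint J (J u)|) ?normr_gt0//.
  rewrite -expr2 sqr_norm_inner -Jadj -[leLHS]ger0_norm; last first.
    by rewrite Jadj -sqr_norm_inner exprn_ge0.
  by rewrite (le_trans (Cauchy_Schwarz _ _))// ler_pM.
apply: inner_inj => z /=.
rewrite -(adjointE (contraction_bounded (T_contr i))) -!Jadj !JTU.
exact: unitary_inner.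
Qed.

End Implications.

Theorem theorem1p3 (R : realType) (H : hilbertType R) (d : nat)
    (d_gt0 : (0 < d)%N) (T : 'I_d -> {linear H -> H})
    (T_comm : commuting T) (T_contr : forall i, contraction_op (T i)) :
  [<-> (exists A : {linear H -> H}, toeplitz_ops T A /\ exists x, A x <> 0);
       ~ pure (adjoint (product_op T));
       (exists E : triple H d,
          canonical_unitary_pseudo_extension T E /\
          forall F : triple H d,
            canonical_unitary_pseudo_extension T F ->
            unitarily_equivalent E F)].
Proof.
tfae.
- by move=> [A [At Anz]]; exact: toeplitz_not_pure At Anz.
- exact: not_pure_canonical.
- by move=> [E [[unitE _] _]]; exact: unitary_pseudo_extension_toeplitz unitE.
Qed.
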